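(* Let $q_E\colon E\to M$ be a smooth vector bundle, let $\Delta\colon \Gamma(TM\oplus E^* )\times\Gamma(E\oplus T^*M)\to\Gamma(E\oplus T^*M)$ be a Dorfman connection, and let $\nu,\nu_1,\nu_2\in\Gamma(TM\oplus E^* )$ and $\tau,\tau_1,\tau_2\in\Gamma(E\oplus T^*M)$. Then, as functions on $E$: 1. $\langle \sigma^\Delta(\nu_1), \sigma^\Delta(\nu_2)\rangle=\ell_{\mathrm{Skew}_\Delta(\nu_1, \nu_2)}$; 2. $\langle \sigma^\Delta(\nu),\tau^\uparrow\rangle=q_E^*\langle \nu, \tau\rangle$; 3. $\langle \tau_1^\uparrow, \tau_2^\uparrow\rangle=0$.
   Context: Everything is smooth. $TM\oplus E^*$ is anchored by $\mathrm{pr}_{TM}$ and paired with $E\oplus T^*M$ by $\langle (X,\varepsilon),(e,\theta)\rangle=\langle\varepsilon,e\rangle+\langle\theta,X\rangle$. A Dorfman connection here is an $\mathbb R$-bilinear map $\Delta\colon \Gamma(TM\oplus E^* )\times\Gamma(E\oplus T^*M)\to\Gamma(E\oplus T^*M)$ such that for all $f\in C^\infty(M)$, $\nu=(X,\varepsilon)$, $\tau$: (a) $\Delta_{f\nu}\tau=f\Delta_\nu\tau+\langle\nu,\tau\rangle(0,\mathbf df)$; (b) $\Delta_\nu(f\tau)=f\Delta_\nu\tau+X(f)\tau$; (c) $\Delta_\nu(0,\mathbf df)=(0,\mathbf d(X(f)))$. Its dual bracket $[\![\cdot,\cdot]\!]_\Delta$ on $\Gamma(TM\oplus E^* )$ is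 defined by $\langle[\![\nu_1,\nu_2]\!]_\Delta,\tau\rangle=\mathrm{pr}_{TM}(\nu_1)\langle\nu_2,\tau\rangle-\langle\nu_2,\Delta_{\nu_1}\tau\rangle$. Set $\mathrm{Skew}_\Delta(\nu_1,\nu_2)=\mathrm{pr}_{E^*}([\![\nu_1,\nu_2]\!]_\Delta+[\![\nu_2,\nu_1]\!]_\Delta)\in\Gamma(E^* )$ (this is $C^\infty(M)$-bilinear). For $\varepsilon\in\Gamma(E^* )$, $\ell_\varepsilon\in C^\infty(E)$ is the fibrewise linear function $e_m\mapsto\langle\varepsilon(m),e_m\rangle$. For $(e,\theta)\in\Gamma(E\oplus T^*M)$, the section $(e,\theta)^\uparrow$ of $TE\oplus T^*E\to E$ is $(e,\theta)^\uparrow(e'_m)=\big(\tfrac{d}{dt}|_{t=0}(e'_m+te(m)),\ (T_{e'_m}q_E)^t\theta(m)\big)$. For $(X,\varepsilon)\in\Gamma(TM\oplus E^* )$, the horizontal lift $\sigma^\Delta(X,\varepsilon)\in\Gamma_E(TE\oplus T^*E)$ is $\sigma^\Delta(X,\varepsilon)(e_m)=(T_me\,X(m),\mathbf d_{e_m}\ell_\varepsilon)-(\Delta_{(X,\varepsilon)}(e,0))^\uparrow(e_m)$, for any $e\in\Gamma(E)$ with $e(m)=e_m$ (this is independent of the choice of $e$). The pairing on $TE\oplus T^*E\to E$ is the canonical one, $\langle(v,\theta),(w,\eta)\rangle=\theta(w)+\eta(v)$. *)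

(* Defs.v *)
From mathcomp Require Import all_boot all_order all_algebra.
From mathcomp Require Import all_classical all_reals all_analysis.

Set Implicit Arguments.
Unset Strict Implicit.
Unset Printing Implicit Defensive.

Import Order.TTheory GRing.Theory Num.Theory numFieldNormedType.Exports.
Local Open Scope classical_set_scope.
Local Open Scope ring_scope.

(** Smooth maps on open subsets of R^n, by iterated Frechet differentials.
    Only meaningful for U open; the values of f outside U are irrelevant. *)

Fixpoint C_on (R : realType) (V W : normedModType R) (r : nat)
    (U : set V) (f : V -> W) : Prop :=
  match r with
  | 0%N => forall x, U x -> {for x, continuous f}
  | r'.+1 => (forall x, U x -> differentiable f x) /\
             (forall h, C_on r' U (fun x => 'd f x h))
  end.

Definition smooth_on (R : realType) (V W : normedModType R)
    (U : set V) (f : V -> W) : Prop := forall r, C_on r U f.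

(** A chart is a partial bijection between [chart_dom] and an open subset of
    R^n; [chart_inv] is arbitrary outside [chart_img]. *)
Record chart (R : realType) (T : Type) (n : nat) := Chart {
  chart_dom : set T;
  chart_map : T -> 'rV[R]_n;
  chart_inv : 'rV[R]_n -> T }.

Definition chart_img (R : realType) (T : Type) (n : nat) (c : chart R T n)
  (U : set T) : set 'rV[R]_n := chart_map c @` (chart_dom c `&` U).

(** The atlas is presented as a family with a distinguished chart around each
    point. Every smooth structure has such an atlas. *)
Record manifold (R : realType) (n : nat) := Manifold {
  points :> topologicalType;
  points_hausdorff : hausdorff_space points;
  points_second_countable : @second_countable points;
  chart_at : points -> chart R points n;
  mem_chart : forall p, chart_dom (chart_at p) p;
  chart_dom_open : forall p, open (chart_dom (chart_at p));
  chart_img_open : forall p, open (chart_img (chart_at p) setT);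
  chart_mapK : forall p q, chart_dom (chart_at p) q ->
        chart_inv (chart_at p) (chart_map (chart_at p) q) = q;
  chart_map_continuous : forall p q, chart_dom (chart_at p) q ->
        {for q, continuous (chart_map (chart_at p))};
  chart_inv_continuous : forall p x, chart_img (chart_at p) setT x ->
        {for x, continuous (chart_inv (chart_at p))};
  chart_change_smooth : forall p q,
        smooth_on (chart_img (chart_at p) (chart_dom (chart_at q)))
        (chart_map (chart_at q) \o chart_inv (chart_at p)) }.

(** Smooth vector bundle of rank k over M, given by its fibres and local
    trivialisations with smooth transition functions. Again there is a
    distinguished trivialisation around each point. *)
Record vbundle (R : realType) (n : nat) (M : manifold R n) (k : nat) :=
  VBundle {
  fibre :> M -> vectType R;
  tdom : M -> set M;
  triv : M -> forall m : M, {linear fibre m -> 'rV[R]_k};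
  untriv : M -> forall m : M, 'rV[R]_k -> fibre m;
  mem_tdom : forall p, tdom p p;
  tdom_open : forall p, open (tdom p);
  trivK : forall p m, tdom p m -> cancel (triv p m) (untriv p m);
  untrivK : forall p m, tdom p m -> cancel (untriv p m) (triv p m);
  triv_change_smooth : forall a b p w,
        smooth_on (chart_img (chart_at p) (tdom a `&` tdom b))
          (fun x => let m := chart_inv (chart_at p) x in
                    triv b m (untriv a m w)) }.

(** The total space, as a set with its induced atlas of fibred charts
    (m, v) |-> (chart_map m, triv v). *)
Definition total_space (R : realType) (n : nat) (M : manifold R n) (k : nat)
  (E : vbundle M k) : Type := {m : M & E m}.

Definition tot (R : realType) (n : nat) (M : manifold R n) (k : nat)
  (E : vbundle M k) (m : M) (v : E m) : total_space E :=
  existT (fun m => E m) m v.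

Definition qE (R : realType) (n : nat) (M : manifold R n) (k : nat)
  (E : vbundle M k) (x : total_space E) : M := projT1 x.

Definition total_chart_at (R : realType) (n : nat) (M : manifold R n)
    (k : nat) (E : vbundle M k) (x0 : total_space E) :
    chart R (total_space E) (n + k) :=
  let m0 := qE x0 in
  Chart
    [set x | (chart_dom (chart_at m0) `&` tdom E m0) (qE x)]
    (fun x => row_mx (chart_map (chart_at m0) (qE x))
                     (triv E m0 (qE x) (projT2 x)))
    (fun y => let m := chart_inv (chart_at m0) (lsubmx y) in
              tot (untriv E m0 m (rsubmx y))).

(** Tangent calculus for a family A of charts around the points of T.
    T_pT is R^n seen through the distinguished chart at p. *)
Definition tangent (R : realType) (T : Type) (n : nat)
  (A : T -> chart R T n) (p : T) : vectType R := 'rV[R]_n.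

Definition vdual (R : realType) (V : vectType R) : vectType R := 'Hom(V, R^o).

Definition cotangent (R : realType) (T : Type) (n : nat)
  (A : T -> chart R T n) (p : T) : vectType R := vdual (tangent A p).

(** The differential T_pT -> W of a map into a vector space. *)
Definition dvec (R : realType) (T : Type) (n : nat) (A : T -> chart R T n)
    (W : normedModType R) (f : T -> W) (p : T) (v : tangent A p) : W :=
  'd (f \o chart_inv (A p)) (chart_map (A p) p) v.

(** The differential of a real-valued function, as a covector. *)
Definition dfun (R : realType) (T : Type) (n : nat) (A : T -> chart R T n)
    (f : T -> R) (p : T) : cotangent A p :=
  linfun ('d (f \o chart_inv (A p)) (chart_map (A p) p) : 'rV[R]_n -> R^o).

Definition tmap (R : realType) (T T' : Type) (n n' : nat)
    (A : T -> chart R T n) (A' : T' -> chart R T' n') (F : T -> T') (p : T) :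
    'Hom(tangent A p, tangent A' (F p)) :=
  linfun ('d (chart_map (A' (F p)) \o F \o chart_inv (A p))
            (chart_map (A p) p)).

(** The velocity at 0 of a curve c with c 0 = p. *)
Definition velocity (R : realType) (T : Type) (n : nat)
    (A : T -> chart R T n) (p : T) (c : R -> T) : tangent A p :=
  'D_1 (chart_map (A p) \o c) 0.

(** The canonical pairing on T_pT (+) T*_pT. *)
Definition pair_TT (R : realType) (T : Type) (n : nat)
    (A : T -> chart R T n) (p : T)
    (a b : tangent A p * cotangent A p) : R := a.2 b.1 + b.2 a.1.

Notation TM := (@tangent _ _ _ (@chart_at _ _ _)).
Notation TsM := (@cotangent _ _ _ (@chart_at _ _ _)).
Notation TE := (@tangent _ _ _ (@total_chart_at _ _ _ _ _)).
Notation TsE := (@cotangent _ _ _ (@total_chart_at _ _ _ _ _)).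

(** Smoothness of functions, vector fields, 1-forms, sections of E and
    sections of E^*, in each case in terms of components in local frames. *)
Definition smooth_fun (R : realType) (n : nat) (M : manifold R n)
    (f : M -> R) : Prop :=
  forall p,
    smooth_on (chart_img (chart_at p) setT) (f \o chart_inv (chart_at p)).

Definition smooth_vfield (R : realType) (n : nat) (M : manifold R n)
    (X : forall m : M, TM m) : Prop :=
  forall p, smooth_on (chart_img (chart_at p) setT)
    (fun x => let m := chart_inv (chart_at p) x in
              dvec (chart_map (chart_at p)) (X m)).

(** [frame_vec p m w] is the tangent vector at m with components w in the
    chart at p. *)
Definition frame_vec (R : realType) (n : nat) (M : manifold R n) (p m : M)
    (w : 'rV[R]_n) : TM m :=
  'd (chart_map (chart_at m) \o chart_inv (chart_at p))
     (chart_map (chart_at p) m) w.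

Definition smooth_form (R : realType) (n : nat) (M : manifold R n)
    (theta : forall m : M, TsM m) : Prop :=
  forall p w, smooth_on (chart_img (chart_at p) setT)
    (fun x => let m := chart_inv (chart_at p) x in
              theta m (frame_vec p m w) : R).

Definition smooth_sec (R : realType) (n : nat) (M : manifold R n) (k : nat)
    (E : vbundle M k) (e : forall m : M, E m) : Prop :=
  forall p a, smooth_on (chart_img (chart_at p) (tdom E a))
    (fun x => let m := chart_inv (chart_at p) x in triv E a m (e m)).

Definition smooth_cosec (R : realType) (n : nat) (M : manifold R n) (k : nat)
    (E : vbundle M k) (eps : forall m : M, vdual (E m)) : Prop :=
  forall p a w, smooth_on (chart_img (chart_at p) (tdom E a))
    (fun x => let m := chart_inv (chart_at p) x in eps m (untriv E a m w) : R).

(** Set-theoretic sections of TM (+) E^* and of E (+) T^*M; the elements of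
    Gamma(TM (+) E^* ) and Gamma(E (+) T^*M) are those satisfying
    [smooth_TMEs], resp. [smooth_ETsM]. *)
Definition sec_TMEs (R : realType) (n : nat) (M : manifold R n) (k : nat)
  (E : vbundle M k) : Type := forall m : M, (TM m * vdual (E m))%type.

Definition sec_ETsM (R : realType) (n : nat) (M : manifold R n) (k : nat)
  (E : vbundle M k) : Type := forall m : M, (E m * TsM m)%type.

Definition smooth_TMEs (R : realType) (n : nat) (M : manifold R n) (k : nat)
    (E : vbundle M k) (nu : sec_TMEs E) : Prop :=
  smooth_vfield (fun m => (nu m).1) /\ smooth_cosec (fun m => (nu m).2).

Definition smooth_ETsM (R : realType) (n : nat) (M : manifold R n) (k : nat)
    (E : vbundle M k) (tau : sec_ETsM E) : Prop :=
  smooth_sec (fun m => (tau m).1) /\ smooth_form (fun m => (tau m).2).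

Definition pair_sec (R : realType) (n : nat) (M : manifold R n) (k : nat)
    (E : vbundle M k) (nu : sec_TMEs E) (tau : sec_ETsM E) (m : M) : R :=
  (nu m).2 (tau m).1 + (tau m).2 (nu m).1.

(** The derivative pr_TM(nu)(f). *)
Definition anchor (R : realType) (n : nat) (M : manifold R n) (k : nat)
    (E : vbundle M k) (nu : sec_TMEs E) (f : M -> R) (m : M) : R :=
  dfun (@chart_at _ _ M) f m (nu m).1.

(** The section (0, df) of E (+) T^*M. *)
Definition zero_d (R : realType) (n : nat) (M : manifold R n) (k : nat)
    (E : vbundle M k) (f : M -> R) : sec_ETsM E :=
  fun m => (0, dfun (@chart_at _ _ M) f m).

(** The section (e, 0) of E (+) T^*M. *)
Definition sec_zero (R : realType) (n : nat) (M : manifold R n) (k : nat)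
    (E : vbundle M k) (e : forall m : M, E m) : sec_ETsM E :=
  fun m => (e m, 0).

(** All clauses concern smooth arguments only, so this is a map on smooth
    sections; its values on non-smooth sections are unconstrained. *)
Record dorfman (R : realType) (n : nat) (M : manifold R n) (k : nat)
    (E : vbundle M k) := Dorfman {
  Dorf :> sec_TMEs E -> sec_ETsM E -> sec_ETsM E;
  dorf_smooth : forall nu tau, smooth_TMEs nu -> smooth_ETsM tau ->
        smooth_ETsM (Dorf nu tau);
  dorf_linearl : forall (c : R) nu nu' tau,
        smooth_TMEs nu -> smooth_TMEs nu' -> smooth_ETsM tau ->
        Dorf (fun m => c *: nu m + nu' m) tau =
        (fun m => c *: Dorf nu tau m + Dorf nu' tau m);
  dorf_linearr : forall (c : R) nu tau tau',
        smooth_TMEs nu -> smooth_ETsM tau -> smooth_ETsM tau' ->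
        Dorf nu (fun m => c *: tau m + tau' m) =
        (fun m => c *: Dorf nu tau m + Dorf nu tau' m);
  dorf_scalel : forall f nu tau,
        smooth_fun f -> smooth_TMEs nu -> smooth_ETsM tau ->
        Dorf (fun m => f m *: nu m) tau =
        (fun m => f m *: Dorf nu tau m + pair_sec nu tau m *: zero_d E f m);
  dorf_scaler : forall f nu tau,
        smooth_fun f -> smooth_TMEs nu -> smooth_ETsM tau ->
        Dorf nu (fun m => f m *: tau m) =
        (fun m => f m *: Dorf nu tau m + anchor nu f m *: tau m);
  dorf_d : forall f nu, smooth_fun f -> smooth_TMEs nu ->
        Dorf nu (zero_d E f) = zero_d E (anchor nu f) }.

Definition is_dual_bracket (R : realType) (n : nat) (M : manifold R n)
    (k : nat) (E : vbundle M k) (D : dorfman E) (nu1 nu2 : sec_TMEs E)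
    (nu : sec_TMEs E) : Prop :=
  smooth_TMEs nu /\
  forall tau, smooth_ETsM tau -> forall m,
    pair_sec nu tau m =
    anchor nu1 (pair_sec nu2 tau) m - pair_sec nu2 (D nu1 tau) m.

(** The smooth section characterised by [is_dual_bracket]; it exists because
    the right-hand side there is C^oo(M)-linear in tau, and it is unique because
    the pairing is nondegenerate. *)
Definition dual_bracket (R : realType) (n : nat) (M : manifold R n) (k : nat)
    (E : vbundle M k) (D : dorfman E) (nu1 nu2 : sec_TMEs E) : sec_TMEs E :=
  match pselect (exists nu, is_dual_bracket D nu1 nu2 nu) with
  | left h => projT1 (cid h)
  | right _ => fun m => 0
  end.

Definition Skew (R : realType) (n : nat) (M : manifold R n) (k : nat)
    (E : vbundle M k) (D : dorfman E) (nu1 nu2 : sec_TMEs E) (m : M) :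
    vdual (E m) :=
  (dual_bracket D nu1 nu2 m + dual_bracket D nu2 nu1 m).2.

Definition ell (R : realType) (n : nat) (M : manifold R n) (k : nat)
    (E : vbundle M k) (eps : forall m : M, vdual (E m))
    (x : total_space E) : R :=
  eps (qE x) (projT2 x).

Definition vlift (R : realType) (n : nat) (M : manifold R n) (k : nat)
    (E : vbundle M k) (tau : sec_ETsM E) (x : total_space E) : TE x * TsE x :=
  (velocity (@total_chart_at _ _ _ _ E) x
     (fun t : R => tot (projT2 x + t *: (tau (qE x)).1)),
   ((tau (qE x)).2 \o
      tmap (@total_chart_at _ _ _ _ E) (@chart_at _ _ M) (@qE _ _ _ _ E) x)%VF).

(** The formula for the horizontal lift of nu at the point e(m). *)
Definition hlift_along (R : realType) (n : nat) (M : manifold R n) (k : nat)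
    (E : vbundle M k) (D : dorfman E) (nu : sec_TMEs E)
    (e : forall m : M, E m) (m : M) : TE (tot (e m)) * TsE (tot (e m)) :=
  (tmap (@chart_at _ _ M) (@total_chart_at _ _ _ _ E) (fun m => tot (e m)) m
     (nu m).1,
   dfun (@total_chart_at _ _ _ _ E) (ell (fun m => (nu m).2)) (tot (e m)))
  - vlift (D nu (sec_zero e)) (tot (e m)).

(** The horizontal lift at x is computed with any smooth section e of E through
    x. Such e exists and the value does not depend on it, so one is chosen. *)
Definition hlift (R : realType) (n : nat) (M : manifold R n) (k : nat)
    (E : vbundle M k) (D : dorfman E) (nu : sec_TMEs E) (x : total_space E) :
    TE x * TsE x :=
  match pselect (exists e : forall m : M, E m,
                   smooth_sec e /\ e (qE x) = projT2 x) with
  | left h => hlift_along D nu (projT1 (cid h)) (qE x)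
  | right _ => 0
  end.

(* Main.v *)
From HB Require Import structures.
Require Import Defs.
From mathcomp Require Import all_boot all_order all_algebra.
From mathcomp Require Import all_classical all_reals all_analysis.
From mathcomp Require Import ring.

(** Let x = e(m) for a smooth section e of E, and use the fibred chart of E
    around x, in which a tangent vector is a pair (base part, fibre part). The
    vertical vector defined by tau has base part 0, the differential of q_E
    returns the base part, and the differential of e sends X to a vector with
    base part X. This gives four evaluations:
    - a covector pulled back from M vanishes on vertical vectors
      ([vlift_vlift]);
    - T q_E o T e is the identity ([tmap_qE_along]);
    - d ell_eps is eps(tau_E) on the vertical vector of tau ([dell_vertical]);
    - d ell_eps (T e X) = X(eps(e)), by the chain rule ([dell_along]).
    Items 2 and 3 are read off. For item 1, with nu_i = (X_i, eps_i), the
    pairing at x is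
      X_2(eps_1(e)) - <nu_1, Delta_(nu_2) (e, 0)>
      + X_1(eps_2(e)) - <nu_2, Delta_(nu_1) (e, 0)>,
    and these are the dual brackets of (nu_2, nu_1) and (nu_1, nu_2) paired
    with (e, 0) ([hlift_along_pair]).

    Lifts and dual brackets are selected among smooth sections with a given
    property, so the computation has content only once such sections exist.
    Existence rests on bump functions, made from the flat function exp(-1/t),
    which extend local sections by zero. A constant section in a
    trivialisation, cut off in this way, gives a smooth section of E through
    any point ([exists_smooth_sec_through]). For the dual bracket, the
    functional L(tau) = X_1<nu_2, tau> - <nu_2, Delta_(nu_1) tau> is linear
    over smooth functions ([bracket_form_lin]). If chi is supported where
    E (+) T^*M has a frame, then chi^2 tau is a combination of the finitely
    many global sections chi f_i with global smooth coefficients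
    ([frame_expand]); hence L(tau)(m) depends linearly on tau(m) alone
    ([bracket_form_local]) and is the pairing with a vector at m. The
    components of that vector, multiplied by chi, are the functions L(chi f_i),
    so the vectors form a smooth section ([exists_dual_bracket]). *)

Set Implicit Arguments.
Unset Strict Implicit.
Unset Printing Implicit Defensive.

Import Order.TTheory GRing.Theory Num.Theory numFieldNormedType.Exports.
Local Open Scope classical_set_scope.
Local Open Scope ring_scope.

(** * Differentials and the class C^r *)

Section NearDiff.
Context {R : realType} {V W : normedModType R}.
Implicit Types f g : V -> W.

(** The differential is chosen by description from the expansion of f at x;
    uniqueness of that expansion makes it depend on the germ of f only. *)
Lemma near_eq_diff_and_differentiable f g x :
  (\near x, f x = g x) -> differentiable f x ->
  differentiable g x /\ 'd g x = 'd f x :> (V -> W).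
Proof.
move=> fg df.
have E : g \o shift x = cst (g x) + 'd f x +o_ 0 id.
  rewrite -(nbhs_singleton fg); apply/eqaddoP => e e0.
  have /eqaddoP/(_ e e0) H := diff_locally df.
  have : \forall y \near 0, f (y + x) = g (y + x).
    move: fg; rewrite (near_shift 0 x).
    by apply: filterS => y; rewrite /= subr0.
  apply: filterS2 H => y; rewrite !fctE /= => Hy <-; exact: Hy.
have dgf : 'd g x = 'd f x :> (V -> W).
  by apply: diff_unique => //; exact: diff_continuous.
split => //; apply/diff_locallyP; rewrite dgf; split => //.
exact: diff_continuous.
Unshelve. all: by end_near. Qed.

Lemma near_eq_differentiable f g x : (\near x, f x = g x) ->
  differentiable f x -> differentiable g x.
Proof. by move=> fg /(near_eq_diff_and_differentiable fg)[]. Qed.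

Lemma near_eq_diff f g x : (\near x, f x = g x) -> differentiable f x ->
  'd g x = 'd f x :> (V -> W).
Proof. by move=> fg /(near_eq_diff_and_differentiable fg)[]. Qed.

End NearDiff.

Section Cr.
Context {R : realType}.

Lemma C_on_sub (V W : normedModType R) r (U U' : set V) (f : V -> W) :
  U' `<=` U -> C_on r U f -> C_on r U' f.
Proof.
move=> s; elim: r f => [|r IH] f /=; first by move=> H x /s; exact: H.
by move=> [d D]; split => [x /s|h]; [exact: d|exact: IH].
Qed.

Lemma C_on_eq (V W : normedModType R) r (U : set V) (f g : V -> W) :
  open U -> (forall x, U x -> f x = g x) -> C_on r U f -> C_on r U g.
Proof.
move=> oU; elim: r f g => [|r IH] f g fg /=.
  move=> H x Ux; have fgx : \near x, f x = g x.
    by near=> y; apply: fg; near: y; exact: open_nbhs_nbhs.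
  rewrite /prop_for /continuous_at -(fg _ Ux).
  by apply: cvg_trans (near_eq_cvg fgx) _; exact: H x Ux.
have fgx x : U x -> \near x, f x = g x.
  by move=> Ux; near=> y; apply: fg; near: y; exact: open_nbhs_nbhs.
move=> [d D]; split => [x Ux|h].
  exact: near_eq_differentiable (fgx _ Ux) (d _ Ux).
apply: IH (D h) => x Ux.
exact: esym (congr1 (@^~ h) (near_eq_diff (fgx _ Ux) (d _ Ux))).
Unshelve. all: by end_near. Qed.

(** Smoothness is checked on neighbourhoods; this is what makes extension by
    zero and chart-by-chart arguments possible. *)
Lemma C_on_local (V W : normedModType R) r (U : set V) (f : V -> W) :
  (forall x, U x -> exists2 U', open_nbhs x U' & C_on r U' f) ->
  C_on r U f.
Proof.
elim: r f => [|r IH] f /= H.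
  by move=> x /H[U' [_ U'x]]; exact.
split=> [x /H[U' [_ U'x] [d _]]|h]; first exact: d.
by apply: IH => x /H[U' U'x [_ D]]; exists U'.
Qed.

Lemma C_on_cst (V W : normedModType R) r (U : set V) (c : W) :
  C_on r U (fun _ : V => c).
Proof.
elim: r c => [|r IH] c /=; first by move=> x _; exact: cst_continuous.
split=> [x _|h]; first exact: differentiable_cst.
rewrite (_ : (fun x => _) = fun _ => 0) //.
by apply/funext => x; exact: (congr1 (@^~ h) (diff_cst c x)).
Qed.

Lemma C_onW (V W : normedModType R) r (U : set V) (f : V -> W) :
  C_on r.+1 U f -> C_on r U f.
Proof.
elim: r f => [|r IH] f /= [d D]; last by split => // h; exact: IH (D h).
by move=> x /d; exact: differentiable_continuous.
Qed.

Lemma C_onD (V W : normedModType R) r (U : set V) (f g : V -> W) :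
  open U -> C_on r U f -> C_on r U g -> C_on r U (fun x => f x + g x).
Proof.
move=> oU; elim: r f g => [|r IH] f g /=.
  by move=> cf cg x Ux; apply: continuousD; [exact: cf|exact: cg].
move=> [df Df] [dg Dg]; split=> [x Ux|h].
  by apply: differentiableD; [exact: df|exact: dg].
apply: C_on_eq (IH _ _ (Df h) (Dg h)) => // x Ux.
exact: esym (congr1 (@^~ h) (diffD (df _ Ux) (dg _ Ux))).
Qed.

Lemma C_on_sum (V W : normedModType R) r (U : set V) (I : Type) (s : seq I)
    (f : I -> V -> W) : open U -> (forall i, C_on r U (f i)) ->
  C_on r U (fun x => \sum_(i <- s) f i x).
Proof.
move=> oU H; elim: s => [|i s IH].
  by under eq_fun do rewrite big_nil; exact: C_on_cst.
by under eq_fun do rewrite big_cons; exact: C_onD.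
Qed.

Lemma C_onM (V : normedModType R) r (U : set V) (f g : V -> R) :
  open U -> C_on r U f -> C_on r U g -> C_on r U (fun x => f x * g x).
Proof.
move=> oU; elim: r f g => [|r IH] f g.
  by move=> cf cg x Ux; apply: continuousM; [exact: cf|exact: cg].
move=> Cf Cg; have [cf cg] := (C_onW Cf, C_onW Cg).
case: Cf => df Df; case: Cg => dg Dg; split=> [x Ux|h].
  by apply: differentiableM; [exact: df|exact: dg].
have H := C_onD oU (IH _ _ cf (Dg h)) (IH _ _ cg (Df h)).
apply: C_on_eq H => // x Ux.
exact: esym (congr1 (@^~ h) (diffM (df _ Ux) (dg _ Ux))).
Qed.

Lemma C_onZ (V : normedModType R) r (U : set V) (c : R) (f : V -> R) :
  open U -> C_on r U f -> C_on r U (fun x => c * f x).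
Proof. by move=> oU; apply: C_onM => //; exact: C_on_cst. Qed.

Lemma C_on_lin (V W W' : normedModType R) r (U : set V) (f : V -> W)
    (l : {linear W -> W'}) : open U -> continuous l ->
  C_on r U f -> C_on r U (fun x => l (f x)).
Proof.
move=> oU cl; elim: r f => [|r IH] f /=.
  by move=> cf x Ux; apply: continuous_comp; [exact: cf|exact: cl].
move=> [df Df]; split=> [x Ux|h].
  by apply: differentiable_comp; [exact: df|exact: linear_differentiable].
apply: C_on_eq (IH _ (Df h)) => // x Ux.
have lx := linear_differentiable (f x) cl.
rewrite -[LHS](congr1 (@^~ ('d f x h)) (diff_lin (f x) cl)).
exact: esym (congr1 (@^~ h) (diff_comp (df _ Ux) lx)).
Qed.

Lemma C_on_id_lin (V W : normedModType R) r (U : set V)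
    (l : {linear V -> W}) : continuous l -> C_on r U l.
Proof.
case: r => [|r] cl /=; first by move=> x _; exact: cl.
split=> [x _|h]; first exact: linear_differentiable.
rewrite (_ : (fun x => _) = cst (l h)); first exact: C_on_cst.
by apply/funext => x; exact: (congr1 (@^~ h) (diff_lin x cl)).
Qed.

Definition coordl m (j : 'I_m) (v : 'rV[R]_m) : R := v 0 j.

Fact coordl_is_linear m (j : 'I_m) : linear (@coordl m j).
Proof. by move=> a u v; rewrite /coordl !mxE. Qed.

HB.instance Definition _ m (j : 'I_m) :=
  GRing.isLinear.Build R 'rV[R]_m R *:%R (@coordl m j) (@coordl_is_linear m j).

Lemma coordl_continuous m (j : 'I_m) : continuous (coordl j).
Proof. exact: coord_continuous. Qed.

Lemma C_on_coord (V : normedModType R) m r (U : set V) (F : V -> 'rV[R]_m) j :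
  open U -> C_on r U F -> C_on r U (fun x => F x 0 j : R).
Proof. by move=> oU; apply: (C_on_lin oU (@coordl_continuous m j)). Qed.

(** Together with the coordinate maps this reduces smoothness of vector-valued
    maps to scalar-valued ones. *)
Lemma C_on_scalel (V W : normedModType R) r (U : set V) (f : V -> R) (w : W) :
  open U -> C_on r U f -> C_on r U (fun x => f x *: w).
Proof.
move=> oU; elim: r f => [|r IH] f.
  by move=> cf x Ux; apply: cvgZr_tmp; exact: cf.
move=> [df Df]; split=> [x Ux|h]; first exact: differentiableZl (df _ Ux).
apply: C_on_eq (IH _ (Df h)) => // x Ux.
exact: esym (congr1 (@^~ h) (diffZl w (df _ Ux))).
Qed.

Lemma C_on_row (V : normedModType R) m r (U : set V) (F : V -> 'rV[R]_m) :
  open U -> (forall j, C_on r U (fun x => F x 0 j : R)) -> C_on r U F.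
Proof.
move=> oU H; rewrite (_ : F = fun x => \sum_j F x 0 j *: 'e_j).
  by apply: C_on_sum => // j; exact: C_on_scalel.
by apply/funext => x; exact: row_sum_delta.
Qed.

(** The differential of the composite at x in direction h is 'd f (g x)
    applied to the moving vector 'd g x h. Decomposing that vector along a
    fixed finite basis e turns it into a sum of products of functions to which
    the induction hypothesis applies; hence the finite dimension of the middle
    space. *)
Lemma C_on_comp (V V' : normedModType R) m r (U : set V) (U' : set V')
    (c : 'I_m -> {linear V' -> R}) (e : 'I_m -> V')
    (f : V' -> R) (g : V -> V') :
  open U -> (forall j, continuous (c j)) ->
  (forall v, v = \sum_j c j v *: e j) ->
  (forall x, U x -> U' (g x)) ->
  C_on r U' f -> C_on r U g -> C_on r U (fun x => f (g x)).
Proof.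
move=> oU cc ce UU'; elim: r f g UU' => [|r IH] f g UU'.
  by move=> cf cg x Ux; apply: continuous_comp; [exact: cg|exact/cf/UU'].
move=> [df Df] Cg; have cg := C_onW Cg; case: Cg => dg Dg; split=> [x Ux|h].
  by apply: differentiable_comp; [exact: dg|exact/df/UU'].
have H : C_on r U
    (fun x => \sum_j c j ('d g x h) * 'd f (g x) (e j)).
  apply: C_on_sum => // j; apply: C_onM => //; last exact: IH (Df _) cg.
  exact: C_on_lin (Dg h).
apply: C_on_eq H => // x Ux.
rewrite [RHS](congr1 (@^~ h) (diff_comp (dg _ Ux) (df _ (UU' _ Ux)))) /=.
rewrite [in RHS](ce ('d g x h)) linear_sum.
by apply: eq_bigr => j _; rewrite linearZ.
Qed.

Lemma C_on_comp1 (V : normedModType R) r (U : set V) (U' : set R)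
    (f : R -> R) (g : V -> R) :
  open U -> (forall x, U x -> U' (g x)) ->
  C_on r U' f -> C_on r U g -> C_on r U (fun x => f (g x)).
Proof.
move=> oU; apply: (C_on_comp (c := fun _ : 'I_1 => idfun) (e := fun=> 1)) => //.
  by move=> _ v; exact: cvg_id.
by move=> v; rewrite big_ord1 /= [RHS]mulr1.
Qed.

Lemma C_on_compr (V : normedModType R) m r (U : set V) (U' : set 'rV[R]_m)
    (f : 'rV[R]_m -> R) (g : V -> 'rV[R]_m) :
  open U -> (forall x, U x -> U' (g x)) ->
  C_on r U' f -> C_on r U g -> C_on r U (fun x => f (g x)).
Proof.
move=> oU; apply: (C_on_comp (c := @coordl m) (e := fun j => 'e_j)) => //.
  exact: coordl_continuous.
exact: row_sum_delta.
Qed.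

(** The derivative of the inverse is minus its square, so the induction closes
    with the product rule. *)
Lemma C_on_inv r (U : set R) : (forall x, U x -> x != 0) -> open U ->
  C_on r U (GRing.inv : R -> R).
Proof.
move=> U0 oU; elim: r => [|r IH].
  by move=> x /U0 x0; exact: differentiable_continuous (differentiable_Rinv x0).
split=> [x /U0|h]; first exact: differentiable_Rinv.
have := C_onZ (- h) oU (C_onM oU IH IH).
apply: C_on_eq => // x Ux.
rewrite [RHS](congr1 (@^~ h) (diff_Rinv (U0 _ Ux))).
by rewrite -invfM -expr2 mulNr mulrC -mulNr.
Qed.

Lemma C_on_div (V : normedModType R) r (U : set V) (f g : V -> R) :
  open U -> (forall x, U x -> g x != 0) -> C_on r U f -> C_on r U g ->
  C_on r U (fun x => f x / g x).
Proof.
move=> oU U0 Cf Cg; apply: C_onM => //.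
apply: (C_on_comp1 (U' := [set x : R | x != 0])) => //.
exact: C_on_inv.
Qed.

End Cr.

(** * The flat function exp(-1/t) *)

Section Flat.
Context {R : realType}.

(** The functions t^-k exp(-1/t), extended by 0. The powers of 1/t are carried
    along because the linear span of the family is then stable under
    derivation. *)
Definition flat (k : nat) (t : R) : R :=
  if 0 < t then t^-1 ^+ k * expR (- t^-1) else 0.

Lemma flat_le0 k t : t <= 0 -> flat k t = 0.
Proof. by rewrite /flat ltNge => ->. Qed.

Lemma flat0_gt0 t : 0 < t -> 0 < flat 0 t.
Proof. by move=> t0; rewrite /flat t0 expr0 mul1r expR_gt0. Qed.

(** With s = 1/t the claim is s^(k+2) <= (k+2)^(k+2) exp s, the (k+2)-nd power
    of s/(k+2) <= exp (s/(k+2)). The factor t^2 gives derivative 0 at the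
    origin. *)
Lemma flat_bound k : exists C : R, forall t, `|flat k t| <= C * t ^+ 2.
Proof.
exists (k.+2%:R ^+ k.+2) => t; case: (ltP 0 t) => t0; last first.
  by rewrite flat_le0 // normr0 mulr_ge0 ?sqr_ge0 ?exprn_ge0 ?ler0n.
have s0 : 0 < t^-1 by rewrite invr_gt0.
rewrite /flat t0 ger0_norm ?mulr_ge0 ?expR_ge0 ?exprn_ge0 ?(ltW s0) //.
have tE : t ^+ 2 = t^-1 ^- 2 by rewrite exprVn invrK.
rewrite tE; set s := t^-1 in s0 *.
have N0 : 0 < k.+2%:R :> R by rewrite ltr0n.
rewrite expRN ler_pdivrMr ?expR_gt0 // mulrAC ler_pdivlMr ?exprn_gt0 //.
have sE : s = k.+2%:R * (s / k.+2%:R) by rewrite mulrC divfK ?lt0r_neq0.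
rewrite -exprD addn2 [in expR s]sE expRM_natl.
rewrite -exprMn ler_pXn2r ?nnegrE ?mulr_ge0 ?expR_ge0 ?(ltW s0) ?(ltW N0) //.
rewrite -ler_pdivrMl // mulrC.
by rewrite (le_trans _ (expR_ge1Dx _)) // lerDr.
Qed.

Lemma is_derive_flat k (t : R) :
  is_derive t 1 (flat k) (- k%:R * flat k.+1 t + flat k.+2 t).
Proof.
case: (ltgtP t 0) => t0.
- have <- : 0 = - k%:R * flat k.+1 t + flat k.+2 t.
    by rewrite !flat_le0 ?(ltW t0) // mulr0 addr0.
  apply: (near_eq_is_derive _ (is_derive_cst 0 t 1)).
  by near=> u; rewrite flat_le0 // ltW //; near: u; exact: lt_nbhsl.
- have tn0 : t != 0 by rewrite gt_eqF.
  have dV : is_derive t 1 (fun u : R => u^-1) (- t^-1 ^+ 2).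
    split; first exact: derivableV.
    by rewrite (deriveV (f := id)) // derive_id exprVn [LHS]mulr1.
  have dE : is_derive t 1 (fun u => expR (- u^-1)) (expR (- t^-1) * t^-1 ^+ 2).
    have dN : is_derive t 1 (fun u : R => - u^-1) (t^-1 ^+ 2).
      by rewrite -[_ ^+ 2]opprK; exact: is_deriveN.
    have eD := is_derive_expR (- t^-1).
    split.
      apply: diff_derivable; apply: (@differentiable_comp _ _ _ _ _ expR);
        by apply/derivable1_diffP.
    by rewrite -derive1E (@derive1_comp _ _ expR) // !derive1E !derive_val.
  have dX := @is_deriveX _ _ _ k _ _ _ dV.
  have dM := @is_deriveM _ _ _ _ _ _ _ _ dX dE.
  apply: (@near_eq_is_derive _ _ _ _ _ _ _ _ _ (is_derive_eq dM _)).
    near=> u; rewrite /flat ifT ?fctE ?exprfctE //; near: u; exact: lt_nbhsr.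
  rewrite /flat t0 /GRing.scale /= fctE.
  by case: k {dX dM} => [|k] /=; rewrite ?expr0 ?exprS; ring.
- rewrite t0 !flat_le0 // mulr0 addr0; have [C HC] := flat_bound k.
  have H : (fun h => h^-1 *: ((flat k \o shift 0) (h *: 1) - flat k 0)) @ 0^'
      --> (0 : R).
    rewrite flat_le0 //.
    apply/cvgr0Pnorm_le => e e0; near=> h; rewrite /= addr0 subr0 [h *: 1]mulr1.
    have hn0 : h != 0 by near: h; exact: nbhs_dnbhs_neq.
    rewrite normrM normfV ler_pdivrMl ?normr_gt0 // (le_trans (HC h)) //.
    rewrite -real_normK ?num_real // expr2 mulrCA ler_wpM2l //.
    apply: le_trans (ler_wpM2r (normr_ge0 h) (ler_norm C)) _.
    have : `|h| <= e / (1 + `|C|).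
      near: h; apply: dnbhs0_le; rewrite divr_gt0 // ltr_wpDr //.
    rewrite ler_pdivlMr ?ltr_wpDr // mulrDr mulr1 mulrC; apply: le_trans.
    by rewrite mulrC lerDr.
  split; first by apply/cvg_ex; exists 0.
  exact: cvg_lim H.
Unshelve. all: by end_near. Qed.

Lemma C_on_flat r k : C_on r setT (flat k).
Proof.
have df k' t := @is_derive_flat k' t.
elim: r k => [|r IH] k.
  by move=> t _; apply: differentiable_continuous; apply/derivable1_diffP.
split=> [t _|h]; first by apply/derivable1_diffP.
have H := C_onZ h openT
  (C_onD openT (C_onZ (- k%:R) openT (IH k.+1)) (IH k.+2)).
apply: C_on_eq H; first exact: openT.
move=> t _; have dt := deriv1E (ex_derive (is_derive := df k t)).
rewrite [RHS](congr1 (@^~ h) dt).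
by rewrite derive1E derive_val.
Qed.

End Flat.

(** * Smooth functions in charts *)

Local Notation dom p := (chart_dom (chart_at p)).
Local Notation map p := (chart_map (chart_at p)).
Local Notation inv p := (chart_inv (chart_at p)).
Local Notation img p := (chart_img (chart_at p)).

Section Atlas.
Context {R : realType} {n : nat} (M : manifold R n).
Implicit Types (p q m : M) (U : set M) (f g : M -> R).

Lemma mem_img p U m : dom p m -> U m -> img p U (map p m).
Proof. by move=> pm Um; exists m. Qed.

Lemma img_inv p U x : img p U x ->
  [/\ dom p (inv p x), U (inv p x) & map p (inv p x) = x].
Proof. by move=> [m [pm Um] <-]; rewrite chart_mapK. Qed.

Lemma img_sub p U U' : U `<=` U' -> img p U `<=` img p U'.
Proof. by move=> UU' _ [m [pm /UU' Um] <-]; exact: mem_img. Qed.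

Lemma open_img p U : open U -> open (img p U).
Proof.
move=> oU; rewrite openE => x Ux; have [pm Um mx] := img_inv Ux.
have Tx : img p setT x by exact: img_sub Ux.
have nU : nbhs (inv p x) U by exact: open_nbhs_nbhs.
have nT : nbhs x (img p setT).
  by apply: open_nbhs_nbhs; split => //; exact: chart_img_open.
near=> y.
have Ty : img p setT y by near: y; exact: nT.
have [py _ <-] := img_inv Ty; apply: mem_img => //.
by near: y; exact: (chart_inv_continuous Tx) nU.
Unshelve. all: by end_near. Qed.

Lemma near_chart_map p U m : open U -> dom p m -> U m ->
  \forall x \near map p m, img p U x.
Proof.
move=> oU pm Um; apply: open_nbhs_nbhs; split; first exact: open_img.
exact: mem_img.
Qed.

(** On the whole manifold this unfolds to [smooth_fun]; the version on an open
    set is needed because components of sections in local frames are only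
    defined there. *)
Definition smooth_in U f : Prop :=
  forall p, smooth_on (img p U) (f \o inv p).

Lemma smooth_in_sub U U' f : U' `<=` U -> smooth_in U f -> smooth_in U' f.
Proof. by move=> UU' sf p r; apply: C_on_sub (sf p r); exact: img_sub. Qed.

Lemma smooth_in_eq U f g : open U -> (forall m, U m -> f m = g m) ->
  smooth_in U f -> smooth_in U g.
Proof.
move=> oU fg sf p r; apply: C_on_eq (sf p r); first exact: open_img.
by move=> x /img_inv[_ Ux _]; exact: fg.
Qed.

Lemma smooth_in_local U f :
  (forall m, U m -> exists U', [/\ open U', U' m & smooth_in U' f]) ->
  smooth_in U f.
Proof.
move=> H p r; apply: C_on_local => x Ux.
have [px /H[U' [oU' U'x sf]] mx] := img_inv Ux.
exists (img p U'); last exact: sf.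
by split; [exact: open_img|rewrite -mx; exact: mem_img].
Qed.

Lemma smooth_in_cst U c : smooth_in U (fun=> c).
Proof. by move=> p r; exact: C_on_cst. Qed.

Lemma smooth_inD U f g : open U -> smooth_in U f -> smooth_in U g ->
  smooth_in U (fun m => f m + g m).
Proof.
move=> oU sf sg p r; have := C_onD _ (sf p r) (sg p r); apply.
exact: open_img.
Qed.

Lemma smooth_inM U f g : open U -> smooth_in U f -> smooth_in U g ->
  smooth_in U (fun m => f m * g m).
Proof.
move=> oU sf sg p r; have := C_onM _ (sf p r) (sg p r); apply.
exact: open_img.
Qed.

Lemma smooth_in_div U f g : open U -> (forall m, U m -> g m != 0) ->
  smooth_in U f -> smooth_in U g -> smooth_in U (fun m => f m / g m).
Proof.
move=> oU g0 sf sg p r; apply: (C_on_div _ _ (sf p r) (sg p r)).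
  exact: open_img.
by move=> x /img_inv[_ /g0].
Qed.

Lemma smooth_in_sum U (I : Type) (s : seq I) (f : I -> M -> R) : open U ->
  (forall i, smooth_in U (f i)) -> smooth_in U (fun m => \sum_(i <- s) f i m).
Proof.
move=> oU sf p r.
have := C_on_sum (f := fun i => f i \o inv p) s _ (fun i => sf i p r); apply.
exact: open_img.
Qed.

(** One chart suffices on an open subset of its domain, since chart changes
    are smooth. *)
Lemma smooth_in_chart p U f : open U -> U `<=` dom p ->
  smooth_on (img p U) (f \o inv p) -> smooth_in U f.
Proof.
move=> oU Up sf q r.
have H : C_on r (img q U) (fun x => (f \o inv p) ((map p \o inv q) x)).
  apply: (C_on_compr (U' := img p U)) (sf r) _; first exact: open_img.
    by move=> x /img_inv[_ Ux _]; apply: mem_img => //; exact: Up.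
  by apply: C_on_sub (chart_change_smooth q p r); exact: img_sub.
apply: C_on_eq H; first exact: open_img.
by move=> x /img_inv[_ /Up Ux _]; rewrite /= chart_mapK.
Qed.

Lemma smooth_in_coord p j : smooth_in (dom p) (fun m => map p m 0 j).
Proof.
move=> q r; have := chart_change_smooth q p r.
by apply: C_on_coord; apply: open_img; exact: chart_dom_open.
Qed.

Lemma smooth_in_diff U f p m : smooth_in U f -> dom p m -> U m ->
  differentiable (f \o inv p) (map p m).
Proof. by move=> sf pm Um; have [+ _] := sf p 1%N; apply; exact: mem_img. Qed.

Lemma near_transition p q m : dom p m -> dom q m ->
  \forall x \near map q m, img q (dom p) x.
Proof. by move=> pm qm; apply: near_chart_map => //; exact: chart_dom_open. Qed.

Lemma diff_transition p q m : dom p m -> dom q m ->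
  differentiable (map p \o inv q) (map q m).
Proof.
move=> pm qm; have [+ _] := chart_change_smooth q p 1%N.
by apply; exact: mem_img.
Qed.

(** Near m, F read in the chart at q is F read in the chart at p after the
    chart change, so this is the chain rule. *)
Lemma diff_chart (W : normedModType R) (F : M -> W) p q m :
  dom p m -> dom q m -> differentiable (F \o inv p) (map p m) ->
  differentiable (F \o inv q) (map q m) /\
  forall v, 'd (F \o inv q) (map q m) v =
     'd (F \o inv p) (map p m) ('d (map p \o inv q) (map q m) v).
Proof.
move=> pm qm dF; have dt := diff_transition pm qm.
have dF' : differentiable (F \o inv p) ((map p \o inv q) (map q m)).
  by rewrite /= chart_mapK.
have E : \forall x \near map q m,
    ((F \o inv p) \o (map p \o inv q)) x = (F \o inv q) x.
  near=> x; have : img q (dom p) x by near: x; exact: near_transition.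
  by move=> /img_inv[_ px _]; rewrite /= chart_mapK.
have dc := differentiable_comp dt dF'.
split; first exact: near_eq_differentiable E dc.
move=> v; apply: (etrans (congr1 (@^~ v) (near_eq_diff E dc))).
apply: (etrans (congr1 (@^~ v) (diff_comp dt dF'))).
by rewrite /= chart_mapK.
Unshelve. all: by end_near. Qed.

Lemma diff_transition_id p m : dom p m ->
  forall v, 'd (map p \o inv p) (map p m) v = v.
Proof.
move=> pm v; have E : \forall x \near map p m, id x = (map p \o inv p) x.
  near=> x; have : img p (dom p) x by near: x; exact: near_transition.
  by move=> /img_inv[].
have idi := is_diff_id (map p m).
apply: (etrans (congr1 (@^~ v) (near_eq_diff E ex_diff))).
exact: (congr1 (@^~ v) diff_val).
Unshelve. all: by end_near. Qed.

(** The Jacobians of a chart change and of its inverse are inverse to each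
    other. *)
Lemma frame_dvec p m (v : TM m) : dom p m -> frame_vec p m (dvec (map p) v) = v.
Proof.
move=> pm; have mm := mem_chart m.
have [_ H] := diff_chart (F := map m) pm mm (diff_transition mm pm).
exact: etrans (esym (H v)) (diff_transition_id mm v).
Qed.

Lemma dfunE f m (v : TM m) :
  (dfun (@chart_at _ _ M) f m v : R) = 'd (f \o inv m) (map m m) v.
Proof. exact: lfunE. Qed.

Lemma dfun_chart f p m (v : TM m) : dom p m ->
  differentiable (f \o inv p) (map p m) ->
  (dfun (@chart_at _ _ M) f m v : R) =
  'd (f \o inv p) (map p m) (dvec (map p) v).
Proof.
move=> pm df; have [_ H] := diff_chart pm (mem_chart m) df.
exact: etrans (dfunE f v) (H v).
Qed.

End Atlas.

(** * Bump functions *)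

Section Bump.
Context {R : realType} {n : nat}.

(** The squared Euclidean distance is polynomial, so this is smooth; for rho >
    0 it is nonzero exactly on the open ball of radius rho around a. *)
Definition bump_rV (a : 'rV[R]_n) (rho : R) (x : 'rV[R]_n) : R :=
  flat 0 (rho ^+ 2 - \sum_i (x 0 i - a 0 i) ^+ 2).

Lemma C_on_bump_rV r a rho : C_on r setT (bump_rV a rho).
Proof.
apply: (C_on_comp1 (U' := setT)) => //; [exact: openT|exact: C_on_flat|].
have Cc j : C_on r setT (fun x : 'rV[R]_n => x 0 j - a 0 j).
  apply: C_onD; [exact: openT| |exact: C_on_cst].
  exact: (@C_on_id_lin _ _ _ _ _ (@coordl R n j)) (@coordl_continuous R n j).
have C2 : C_on r setT (fun x : 'rV[R]_n =>
    rho ^+ 2 + (- 1) * \sum_i (x 0 i - a 0 i) * (x 0 i - a 0 i)).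
  apply: C_onD; [exact: openT|exact: C_on_cst|].
  apply: C_onZ; first exact: openT.
  apply: C_on_sum => [|j]; first exact: openT.
  by apply: C_onM => //; exact: openT.
by apply: C_on_eq C2 => [|x _]; [exact: openT|rewrite mulN1r].
Qed.

Lemma bump_rV_center a rho : 0 < rho -> bump_rV a rho a != 0.
Proof.
move=> r0; rewrite gt_eqF // /bump_rV flat0_gt0 //.
rewrite big1 ?subr0 ?exprn_gt0 // => i _.
by rewrite subrr expr0n.
Qed.

Lemma bump_rV_supp a rho x : 0 <= rho -> bump_rV a rho x != 0 ->
  forall i, `|a 0 i - x 0 i| <= rho.
Proof.
move=> r0 bx i; rewrite leNgt; apply/negP => H; move/eqP: bx; apply.
rewrite /bump_rV flat_le0 // subr_le0 (bigD1 i) //=.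
apply: (@le_trans _ _ ((x 0 i - a 0 i) ^+ 2)); last first.
  by rewrite lerDl; apply: sumr_ge0 => j _; exact: sqr_ge0.
by rewrite -[leRHS]real_normK ?num_real // distrC ler_pXn2r ?nnegrE // ltW.
Qed.

End Bump.

Section ManifoldBump.
Context {R : realType} {n : nat} (M : manifold R n).

(** Support in U is expressed by a closed subset of U outside of which chi
    vanishes. Dividing by chi where it is nonzero replaces a plateau. *)
Definition bump_in (U : set M) (chi : M -> R) : Prop :=
  smooth_fun chi /\
  exists K, [/\ closed K, K `<=` U & forall m, ~ K m -> chi m = 0].

Lemma bump_in_sub U U' chi : U `<=` U' -> bump_in U chi -> bump_in U' chi.
Proof.
move=> UU' [schi [K [cK KU chi0]]]; split => //; exists K; split => //.
exact: subset_trans UU'.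
Qed.

Lemma bump_in_neq0 U chi m : bump_in U chi -> chi m != 0 -> U m.
Proof.
move=> [_ [K [_ KU chi0]]] cm; apply: KU; apply: contrapT => /chi0 c0.
by rewrite c0 eqxx in cm.
Qed.

(** A small closed cube in a chart around m0 is compact, so it is compact in
    M, hence closed because M is Hausdorff; a bump supported in the cube thus
    extends by 0. *)
Lemma exists_bump (U : set M) (m0 : M) : open U -> U m0 ->
  exists2 chi, bump_in U chi & chi m0 != 0.
Proof.
move=> oU Um0; have mm := mem_chart m0.
have := near_chart_map oU mm Um0.
move=> /nbhs_ballP[e /= e0 eU]; set a := map m0 m0 in eU.
have r0 : 0 < e / 2 by rewrite divr_gt0.
set rho := e / 2 in r0.
pose K0 := [set x : 'rV[R]_n |
    forall i, `[a 0 i - rho, a 0 i + rho]%classic (x ord0 i)].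
have K0U : K0 `<=` img m0 U.
  move=> x K0x; apply: eU; split => // i j; rewrite (ord1 i) /ball /= /ball_.
  have := K0x j; rewrite /= in_itv /= => /andP[h1 h2].
  rewrite (@le_lt_trans _ _ rho) // ?ltr_pdivrMr // ?ltr_pMr // ?ltr1n //.
  by rewrite distrC ler_distl h1.
have cK0 : compact K0.
  have := @rV_compact R n (fun i => `[a 0 i - rho, a 0 i + rho]%classic).
  by apply=> i; exact: segment_compact.
pose K := inv m0 @` K0.
have cK : closed K.
  apply: compact_closed; first exact: points_hausdorff.
  apply: continuous_compact => //.
  apply: continuous_in_subspaceT => x /set_mem K0x.
  by apply: (chart_inv_continuous (p := m0)); exact: img_sub (K0U _ K0x).
have KU : K `<=` U by move=> _ [x /K0U/img_inv[_ + _] <-].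
pose chi m := if pselect (dom m0 m) then bump_rV a rho (map m0 m) else 0.
have chi0 m : ~ K m -> chi m = 0.
  rewrite /chi; case: pselect => // pm nK; apply/eqP/negPn/negP => bn0.
  have H := bump_rV_supp (ltW r0) bn0; apply: nK.
  exists (map m0 m); last by rewrite chart_mapK.
  move=> i; rewrite /= in_itv /=; have := H i.
  by rewrite distrC ler_distl.
exists chi; last by rewrite /chi; case: pselect => // pm; exact: bump_rV_center.
split; last by exists K.
apply: (@smooth_in_local _ _ _ setT) => m _.
have [Km|nKm] := pselect (K m).
  exists (dom m0); split; first exact: chart_dom_open.
    by case: Km => x /K0U/img_inv[+ _ _] <-.
  have od := chart_dom_open m0.
  apply: (@smooth_in_chart _ _ _ m0) => // r.
  apply: C_on_eq (C_on_sub _ (C_on_bump_rV r a rho)) => //.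
    exact: open_img.
  move=> x /img_inv[+ _ xE].
  by rewrite /chi /=; case: pselect => //; rewrite xE.
exists (~` K); split => //; first exact: closed_openC.
apply: smooth_in_eq (smooth_in_cst _ 0); first exact: closed_openC.
by move=> x /chi0.
Qed.

Lemma smooth_in_ext0 (V U : set M) (chi f : M -> R) : open V -> open U ->
  bump_in U chi ->
  smooth_in (V `&` U) f -> smooth_in V (fun m => chi m * f m).
Proof.
move=> oV oU [schi [K [cK KU chi0]]] sf; apply: smooth_in_local => m Vm.
have [Km|nKm] := pselect (K m).
  have oVU : open (V `&` U) by exact: openI.
  exists (V `&` U); split => //; first by split => //; exact: KU.
  by apply: smooth_inM => //; exact: (@smooth_in_sub _ _ _ setT).
exists (~` K); split => //; first exact: closed_openC.
apply: smooth_in_eq (smooth_in_cst _ 0); first exact: closed_openC.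
by move=> x /= /chi0 ->; rewrite mul0r.
Qed.

(** Near a point where chi is nonzero, f is the quotient of chi f by chi. *)
Lemma smooth_in_bump (U : set M) (f : M -> R) : open U ->
  (forall chi, bump_in U chi -> smooth_fun (fun m => chi m * f m)) ->
  smooth_in U f.
Proof.
move=> oU H; apply: smooth_in_local => m Um.
have [chi bchi chim] := exists_bump oU Um.
have sf := H _ bchi; have [schi _] := bchi.
(* openness of the nonvanishing locus, from the continuity of chi in charts *)
have oc : open [set m | chi m != 0].
  rewrite openE => x /= cx; have xx := mem_chart x.
  have cc : {for map x x, continuous (chi \o inv x)}.
    by apply: (schi x 0%N); exact: mem_img.
  have : \forall y \near map x x, (chi \o inv x) y != 0.
    have n0 : nbhs ((chi \o inv x) (map x x)) [set y : R | y != 0].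
      by apply: open_nbhs_nbhs; split; [exact: open_neq|rewrite /= chart_mapK].
    exact: cc n0.
  move=> /(chart_map_continuous xx) near_x.
  have nd : nbhs x (dom x).
    by apply: open_nbhs_nbhs; split => //; exact: chart_dom_open.
  rewrite /interior; near=> y.
  have yd : dom x y by near: y; exact: nd.
  have : (chi \o inv x) (map x y) != 0 by near: y; exact: near_x.
  by rewrite /= chart_mapK.
exists [set m | chi m != 0]; split => //.
apply: (@smooth_in_eq _ _ _ _ (fun m => chi m * f m / chi m)) => //.
  by move=> x /= cx; rewrite mulrAC mulfV // mul1r.
by apply: smooth_in_div => //; exact: (@smooth_in_sub _ _ _ setT).
Unshelve. all: by end_near. Qed.

End ManifoldBump.

(** * Smooth sections, pairings and derivatives *)

Section Sections.
Context {R : realType} {n : nat} (M : manifold R n) {k : nat} (E : vbundle M k).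
Implicit Types (p a m : M) (f g : M -> R).

Lemma untriv_decomp a m w : tdom E a m ->
  untriv E a m w = \sum_i w 0 i *: untriv E a m 'e_i.
Proof.
move=> am; apply: (can_inj (trivK am)); rewrite untrivK // linear_sum.
rewrite {1}(row_sum_delta w); apply: eq_bigr => i _.
by rewrite linearZ /= untrivK.
Qed.

Lemma triv_decomp a m (v : E m) : tdom E a m ->
  v = \sum_i (triv E a m v) 0 i *: untriv E a m 'e_i.
Proof. by move=> am; rewrite -untriv_decomp // trivK. Qed.

Lemma form_decomp p m (th : TsM m) (v : TM m) : dom p m ->
  (th v : R) = \sum_j (dvec (map p) v) 0 j * (th (frame_vec p m 'e_j) : R).
Proof.
move=> pm; rewrite -[in LHS](frame_dvec v pm).
rewrite /frame_vec [X in 'd _ _ X]row_sum_delta linear_sum linear_sum.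
by apply: eq_bigr => j _; rewrite !linearZ.
Qed.

Lemma smooth_secP (e : forall m, E m) : smooth_sec e <->
  forall a j, smooth_in (tdom E a) (fun m => triv E a m (e m) 0 j).
Proof.
split=> [se a j p r|H p a r].
  by apply: C_on_coord (se p a r); apply: open_img; exact: tdom_open.
by apply: C_on_row => [|j]; [apply: open_img; exact: tdom_open|exact: H].
Qed.

Lemma img_dom p : img p setT `<=` img p (dom p).
Proof. by move=> x /img_inv[px _ <-]; exact: mem_img. Qed.

Lemma smooth_vfieldP (X : forall m : M, TM m) : smooth_vfield X <->
  forall p j, smooth_in (dom p) (fun m => dvec (map p) (X m) 0 j).
Proof.
split=> [sX p j|H p r].
  have od := chart_dom_open p; apply: (@smooth_in_chart _ _ _ p) => // r.
  apply: (@C_on_coord _ _ _ _ _ (fun x => dvec (map p) (X (inv p x)))).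
    exact: open_img.
  by apply: C_on_sub (sX p r); exact: img_sub.
apply: C_on_row => [|j]; first by apply: open_img; exact: openT.
by apply: C_on_sub (H p j p r); exact: img_dom.
Qed.

Lemma smooth_formP (th : forall m : M, TsM m) : smooth_form th <->
  forall p w, smooth_in (dom p) (fun m => th m (frame_vec p m w) : R).
Proof.
split=> [sth p w|H p w r].
  have od := chart_dom_open p; apply: (@smooth_in_chart _ _ _ p) => // r.
  by apply: C_on_sub (sth p w r); exact: img_sub.
by apply: C_on_sub (H p w p r); exact: img_dom.
Qed.

Lemma smooth_sec0 : smooth_sec (fun m => 0 : E m).
Proof.
apply/smooth_secP => a j; apply: smooth_in_eq (smooth_in_cst _ 0) => [|m _].
  exact: tdom_open.
by rewrite /= linear0 mxE.
Qed.

Lemma smooth_form0 : smooth_form (fun m : M => 0 : TsM m).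
Proof.
apply/smooth_formP => p w; apply: smooth_in_eq (smooth_in_cst _ 0) => [|m _].
  exact: chart_dom_open.
by rewrite /= zero_lfunE.
Qed.

Lemma smooth_cosecP (eps : forall m : M, vdual (E m)) : smooth_cosec eps <->
  forall a w, smooth_in (tdom E a) (fun m => eps m (untriv E a m w) : R).
Proof. by split=> [se a w p|H p a w]; [exact: se|exact: H]. Qed.

(** Near m the pairing is the sum of products of components in the frames at
    m. *)
Lemma smooth_pair nu tau : smooth_TMEs nu -> smooth_ETsM tau ->
  smooth_fun (pair_sec (E := E) nu tau).
Proof.
move=> [/smooth_vfieldP sX /smooth_cosecP se].
move=> [/smooth_secP s1 /smooth_formP s2].
apply: (@smooth_in_local _ _ _ setT) => m _; exists (dom m `&` tdom E m).
have oU : open (dom m `&` tdom E m).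
  by apply: openI; [exact: chart_dom_open|exact: tdom_open].
split => //; first by split; [exact: mem_chart|exact: mem_tdom].
apply: smooth_inD => //.
  apply: (@smooth_in_eq _ _ _ _ (fun x => \sum_i
     (triv E m x (tau x).1) 0 i * ((nu x).2 (untriv E m x 'e_i) : R))) => //.
    move=> x [_ mx]; rewrite [in RHS](triv_decomp (tau x).1 mx) linear_sum.
    by apply: eq_bigr => i _; rewrite linearZ.
  apply: smooth_in_sum => // i; apply: smooth_inM => //.
    exact: smooth_in_sub (s1 m i).
  exact: smooth_in_sub (se m _).
apply: (@smooth_in_eq _ _ _ _ (fun x => \sum_j
   (dvec (map m) (nu x).1) 0 j * ((tau x).2 (frame_vec m x 'e_j) : R))) => //.
  by move=> x [mx _]; rewrite -form_decomp.
apply: smooth_in_sum => // i; apply: smooth_inM => //.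
  exact: smooth_in_sub (sX m i).
exact: smooth_in_sub (s2 m _).
Qed.

(** In a chart, X(f) is the sum of the X^j times the partial derivatives of
    f. *)
Lemma smooth_anchor (nu : sec_TMEs E) f : smooth_TMEs nu -> smooth_fun f ->
  smooth_fun (anchor nu f).
Proof.
move=> [/smooth_vfieldP sX _] sf.
apply: (@smooth_in_local _ _ _ setT) => m _; exists (dom m).
have od := chart_dom_open m; split => //; first exact: mem_chart.
have sd j : smooth_in (dom m) (fun x => 'd (f \o inv m) (map m x) 'e_j).
  apply: (@smooth_in_chart _ _ _ m) => // r.
  have [_ /(_ 'e_j) H] := sf m r.+1.
  apply: C_on_eq (C_on_sub _ H); first exact: open_img.
    by move=> x /img_inv[_ _ xE]; rewrite /= xE.
  exact: img_sub.
apply: (@smooth_in_eq _ _ _ _ (fun x => \sum_j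
   (dvec (map m) (nu x).1) 0 j * 'd (f \o inv m) (map m x) 'e_j)) => //.
  move=> x mx; apply: esym.
  apply: (etrans (dfun_chart _ mx (smooth_in_diff sf mx I))).
  rewrite [X in 'd _ _ X]row_sum_delta linear_sum.
  by apply: eq_bigr => j _; rewrite linearZ.
by apply: smooth_in_sum => // j; exact: smooth_inM.
Qed.

Lemma anchorD (nu : sec_TMEs E) f g m : smooth_fun f -> smooth_fun g ->
  anchor nu (fun m => f m + g m) m = anchor nu f m + anchor nu g m.
Proof.
move=> sf sg; have mm := mem_chart m.
have df := smooth_in_diff sf mm I; have dg := smooth_in_diff sg mm I.
apply: (etrans (dfunE _ _)); apply: (etrans (congr1 (@^~ _) (diffD df dg))).
by apply: esym; exact: (congr2 _ (dfunE _ _) (dfunE _ _)).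
Qed.

Lemma anchorM (nu : sec_TMEs E) f g m : smooth_fun f -> smooth_fun g ->
  anchor nu (fun m => f m * g m) m = f m * anchor nu g m + anchor nu f m * g m.
Proof.
move=> sf sg; have mm := mem_chart m.
have df := smooth_in_diff sf mm I; have dg := smooth_in_diff sg mm I.
apply: (etrans (dfunE _ _)); apply: (etrans (congr1 (@^~ _) (diffM df dg))).
rewrite /= !chart_mapK // /anchor [_ * g m]mulrC.
by congr (_ * _ + _ * _); apply: esym; exact: dfunE.
Qed.

End Sections.

(** * Local frames cut off by bump functions *)

Section Frames.
Context {R : realType} {n : nat} (M : manifold R n) {k : nat} (E : vbundle M k).
Implicit Types (p a m : M) (f g chi : M -> R) (tau : sec_ETsM E).

(** The coordinate 1-forms dx^j of the chart at p. *)
Definition dcoord p (j : 'I_n) (m : M) : TsM m :=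
  dfun (@chart_at _ _ M) (fun m' => map p m' 0 j) m.

Lemma dcoordE p j m (v : TM m) : dom p m ->
  (dcoord p j m v : R) = dvec (map p) v 0 j.
Proof.
move=> pm; apply: (etrans (dfunE _ _)).
have dt := diff_transition pm (mem_chart m).
have cl := @coordl_continuous R n j.
have dl := linear_differentiable ((map p \o inv m) (map m m)) cl.
apply: (etrans (congr1 (@^~ v) (diff_comp dt dl))).
exact: (congr1 (@^~ _) (diff_lin _ cl)).
Qed.

Lemma form_dcoord p m (th : TsM m) : dom p m ->
  th = \sum_j (th (frame_vec p m 'e_j) : R) *: dcoord p j m.
Proof.
move=> pm; apply/lfunP => v; rewrite [LHS](form_decomp th v pm) sum_lfunE.
apply: eq_bigr => j _; rewrite scale_lfunE [RHS]mulrC.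
by congr (_ * _); rewrite dcoordE.
Qed.

Definition sec_along chi a w : sec_ETsM E :=
  fun m => (chi m *: untriv E a m w, 0).

Definition form_along chi p j : sec_ETsM E :=
  fun m => (0, chi m *: dcoord p j m).

(** In any other trivialisation the components are chi times a transition
    function of E. *)
Lemma smooth_sec_along chi a w : bump_in (tdom E a) chi ->
  smooth_ETsM (sec_along chi a w).
Proof.
move=> bchi; split; last exact: smooth_form0.
apply/smooth_secP => b j; have [ob oa] := (tdom_open E b, tdom_open E a).
apply: (@smooth_in_eq _ _ _ _
  (fun m => chi m * triv E b m (untriv E a m w) 0 j)) => //.
  by move=> m _ /=; rewrite linearZ mxE.
apply: (smooth_in_ext0 ob oa bchi) => p r.
rewrite setIC.
apply: (@C_on_coord _ _ _ _ _
  (fun x => triv E b (inv p x) (untriv E a (inv p x) w)) j).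
  by apply: open_img; exact: openI.
exact: (triv_change_smooth E a b p w r).
Qed.

(** In any other chart the components are chi times entries of the Jacobian of
    the chart change. *)
Lemma smooth_form_along chi p j : bump_in (dom p) chi ->
  smooth_ETsM (form_along chi p j).
Proof.
move=> bchi; split; first exact: smooth_sec0.
apply/smooth_formP => q w.
have [oq op] := (chart_dom_open q, chart_dom_open p).
have oqp : open (dom q `&` dom p) by exact: openI.
apply: (@smooth_in_eq _ _ _ _
  (fun m => chi m * dvec (map p) (frame_vec q m w : TM m) 0 j)) => //.
  move=> m qm; rewrite /= scale_lfunE.
  have [->|/(bump_in_neq0 bchi) pm] := eqVneq (chi m) 0.
    by rewrite mul0r scale0r.
  by rewrite dcoordE.
apply: (smooth_in_ext0 oq op bchi).
apply: (@smooth_in_eq _ _ _ _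
  (fun m => 'd (map p \o inv q) (map q m) w 0 j)) => //.
  move=> m [qm pm].
  have [_ H] := diff_chart (mem_chart m) qm (diff_transition pm (mem_chart m)).
  exact: (congr1 (fun v : 'rV[R]_n => v 0 j) (H w)).
apply: (@smooth_in_chart _ _ _ q) => [//||r]; first by move=> m [].
apply: (@C_on_coord _ _ _ _ _
  (fun x => 'd (map p \o inv q) (map q (inv q x)) w) j); first exact: open_img.
have [_ /(_ w) H] := chart_change_smooth q p r.+1.
apply: C_on_eq (C_on_sub _ H); first exact: open_img.
  by move=> x /img_inv[_ _ xE]; rewrite /= xE.
by apply: img_sub => m [].
Qed.

(** A constant section in a trivialisation, cut off by a bump chi and rescaled
    by 1 / chi(m). *)
Lemma exists_smooth_sec_through m (v : E m) :
  exists e, smooth_sec (E := E) e /\ e m = v.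
Proof.
have [chi bchi cm] := exists_bump (tdom_open E m) (mem_tdom E m).
have [se _] := smooth_sec_along ((chi m)^-1 *: triv E m m v) bchi.
exists (fun x => (sec_along chi m ((chi m)^-1 *: triv E m m v) x).1).
split => //=; have mm := mem_tdom E m.
apply: (can_inj (trivK mm)); rewrite linearZ /= untrivK //.
by rewrite scalerA mulfV // scale1r.
Qed.

Definition frame_sec chi p a (x : 'I_k + 'I_n) : sec_ETsM E :=
  match x with
  | inl i => sec_along chi a 'e_i
  | inr j => form_along chi p j
  end.

Definition frame_coord p a (x : 'I_k + 'I_n) m (t : E m * TsM m) : R :=
  match x with
  | inl i => triv E a m t.1 0 i
  | inr j => t.2 (frame_vec p m 'e_j)
  end.

Lemma smooth_frame_sec chi p a x : bump_in (dom p `&` tdom E a) chi ->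
  smooth_ETsM (frame_sec chi p a x).
Proof.
move=> bchi; case: x => [i|j].
  by apply: smooth_sec_along; apply: bump_in_sub bchi => m [].
by apply: smooth_form_along; apply: bump_in_sub bchi => m [].
Qed.

Lemma smooth_frame_coord chi p a x tau : bump_in (dom p `&` tdom E a) chi ->
  smooth_ETsM tau -> smooth_fun (fun m => chi m * frame_coord p a x (tau m)).
Proof.
move=> bchi [/smooth_secP s1 /smooth_formP s2].
have oU : open (dom p `&` tdom E a).
  by apply: openI; [exact: chart_dom_open|exact: tdom_open].
apply: (@smooth_in_ext0 _ _ _ setT _ _ _ openT oU bchi).
rewrite setTI; case: x => [i|j] /=.
  by apply: smooth_in_sub (s1 a i) => m [].
by apply: smooth_in_sub (s2 p 'e_j) => m [].
Qed.

(** One factor chi globalises the frame and the other one globalises the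
    components of tau, so that both sides are made of smooth global
    objects. *)
Lemma frame_expand chi p a tau m : bump_in (dom p `&` tdom E a) chi ->
  (chi m * chi m) *: tau m =
  \sum_x (chi m * frame_coord p a x (tau m)) *: frame_sec chi p a x m.
Proof.
move=> bchi; have [c0|/(bump_in_neq0 bchi) [pm am]] := eqVneq (chi m) 0.
  by rewrite c0 mul0r scale0r big1 // => x _; rewrite mul0r scale0r.
have sum1 (I : finType) (F : I -> E m * TsM m) :
    \sum_i F i = (\sum_i (F i).1, \sum_i (F i).2).
  elim/big_rec3: _ => [|i _ u v _ ->] //.
rewrite sum1 !big_sumType /=; case: (tau m) => e th /=.
congr (_, _).
  rewrite [X in _ + X]big1 ?addr0 => [|j _]; last by rewrite scaler0.
  rewrite [in LHS](triv_decomp e am) scaler_sumr; apply: eq_bigr => i _.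
  by rewrite !scalerA mulrAC -mulrA.
rewrite big1 ?add0r => [|j _]; last by rewrite scaler0.
rewrite [in LHS](form_dcoord th pm) scaler_sumr; apply: eq_bigr => i _.
by rewrite !scalerA mulrAC -mulrA.
Qed.

End Frames.

(** * Existence of the dual bracket *)

Section DualBracket.
Context {R : realType} {n : nat} (M : manifold R n) {k : nat} (E : vbundle M k).
Context (D : dorfman E).
Implicit Types (p a m : M) (f g chi : M -> R) (tau : sec_ETsM E).
Implicit Types (nu : sec_TMEs E).

Lemma smooth_ETsM_lin f tau tau' : smooth_fun f -> smooth_ETsM tau ->
  smooth_ETsM tau' -> smooth_ETsM (fun m => f m *: tau m + tau' m).
Proof.
move=> sf [/smooth_secP s1 /smooth_formP s2].
move=> [/smooth_secP s1' /smooth_formP s2'].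
have sfU U : smooth_in U f by exact: (@smooth_in_sub _ _ _ setT).
split.
  apply/smooth_secP => a j; have oa := tdom_open E a.
  apply: (@smooth_in_eq _ _ _ _ (fun m =>
    f m * triv E a m (tau m).1 0 j + triv E a m (tau' m).1 0 j)) => //.
    by move=> m _ /=; rewrite linearD linearZ !mxE.
  by apply: smooth_inD => //; exact: smooth_inM.
apply/smooth_formP => p w; have op := chart_dom_open p.
apply: (@smooth_in_eq _ _ _ _ (fun m =>
  f m * (tau m).2 (frame_vec p m w) + (tau' m).2 (frame_vec p m w))) => //.
  by move=> m _ /=; rewrite add_lfunE scale_lfunE.
by apply: smooth_inD => //; exact: smooth_inM.
Qed.

Lemma smooth_ETsM0 : @smooth_ETsM R n M k E (fun=> 0).
Proof. by split; [exact: smooth_sec0|exact: smooth_form0]. Qed.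

Lemma pair_sec_lin nu f tau tau' m :
  pair_sec nu (fun m => f m *: tau m + tau' m) m =
  f m * pair_sec nu tau m + pair_sec nu tau' m.
Proof.
rewrite /pair_sec /= linearD linearZ add_lfunE scale_lfunE /=.
rewrite mulrDr; exact: addrACA.
Qed.

(** The right-hand side of the equation that defines the dual bracket. *)
Definition bracket_form nu1 nu2 tau m : R :=
  anchor nu1 (pair_sec nu2 tau) m - pair_sec nu2 (D nu1 tau) m.

Lemma smooth_bracket_form nu1 nu2 tau : smooth_TMEs nu1 -> smooth_TMEs nu2 ->
  smooth_ETsM tau -> smooth_fun (bracket_form nu1 nu2 tau).
Proof.
move=> s1 s2 st; have H1 := smooth_anchor s1 (smooth_pair s2 st).
have H2 := smooth_pair s2 (dorf_smooth D s1 st).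
have H3 : smooth_fun (fun m => -1 * pair_sec nu2 (D nu1 tau) m).
  by apply: (smooth_inM openT) => //; exact: smooth_in_cst.
apply: (smooth_in_eq openT _ (smooth_inD openT H1 H3)) => m _.
by rewrite mulN1r.
Qed.

(** Linearity over smooth functions: by the Leibniz rules both X1<nu2, f tau>
    and <nu2, Delta_nu1 (f tau)> contain the term X1(f) <nu2, tau>, which
    cancels. *)
Lemma bracket_form_lin nu1 nu2 f tau tau' m :
  smooth_TMEs nu1 -> smooth_TMEs nu2 -> smooth_fun f ->
  smooth_ETsM tau -> smooth_ETsM tau' ->
  bracket_form nu1 nu2 (fun m => f m *: tau m + tau' m) m =
  f m * bracket_form nu1 nu2 tau m + bracket_form nu1 nu2 tau' m.
Proof.
move=> s1 s2 sf st st'.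
have [sp sp'] := (smooth_pair s2 st, smooth_pair s2 st').
have sft : smooth_ETsM (fun m => f m *: tau m).
  have := smooth_ETsM_lin sf st smooth_ETsM0; congr smooth_ETsM.
  by apply: functional_extensionality_dep => x; rewrite addr0.
have Dlin : D nu1 (fun m => f m *: tau m + tau' m) =
    (fun m => f m *: D nu1 tau m + (anchor nu1 f m *: tau m + D nu1 tau' m)).
  (* additivity is the case c = 1 of the linearity axiom *)
  have -> : (fun m => f m *: tau m + tau' m) =
      (fun m => 1 *: (f m *: tau m) + tau' m).
    by apply: functional_extensionality_dep => x; rewrite scale1r.
  rewrite (dorf_linearr D 1 s1 sft st') (dorf_scaler D sf s1 st).
  by apply: functional_extensionality_dep => x; rewrite scale1r addrA.
rewrite /bracket_form Dlin !pair_sec_lin.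
have -> : pair_sec nu2 (fun m => f m *: tau m + tau' m) =
    (fun m => f m * pair_sec nu2 tau m + pair_sec nu2 tau' m).
  by apply/funext => x; exact: pair_sec_lin.
rewrite (anchorD _ _ (smooth_inM openT sf sp) sp') anchorM //.
have aux (u A B P A' Q Q' : R) :
  (u * A + B * P + A') - (u * Q + (B * P + Q')) = u * (A - Q) + (A' - Q').
  by ring.
exact: aux.
Qed.

Lemma bracket_form0 nu1 nu2 m : smooth_TMEs nu1 -> smooth_TMEs nu2 ->
  bracket_form nu1 nu2 (fun=> 0) m = 0.
Proof.
move=> s1 s2; have s0 := smooth_ETsM0.
(* 0 = 1 0 + 0 gives L(0) = L(0) + L(0) *)
have := bracket_form_lin m s1 s2 (smooth_in_cst _ 1) s0 s0.
rewrite (_ : (fun m => _) = (fun=> 0)); last first.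
  by apply: functional_extensionality_dep => x; rewrite scale1r addr0.
rewrite mul1r => /eqP.
by rewrite -subr_eq0 opprD addrA subrr sub0r oppr_eq0 => /eqP.
Qed.

Lemma bracket_form_sum nu1 nu2 (I : Type) (s : seq I) (f : I -> M -> R)
    (tau : I -> sec_ETsM E) m :
  smooth_TMEs nu1 -> smooth_TMEs nu2 -> (forall i, smooth_fun (f i)) ->
  (forall i, smooth_ETsM (tau i)) ->
  bracket_form nu1 nu2 (fun m => \sum_(i <- s) f i m *: tau i m) m =
  \sum_(i <- s) f i m * bracket_form nu1 nu2 (tau i) m.
Proof.
move=> s1 s2 sf st.
suff [] : smooth_ETsM (fun m => \sum_(i <- s) f i m *: tau i m) /\
  bracket_form nu1 nu2 (fun m => \sum_(i <- s) f i m *: tau i m) m =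
  \sum_(i <- s) f i m * bracket_form nu1 nu2 (tau i) m by [].
elim: s => [|i s [IHs IH]].
  have -> : (fun m => \sum_(i <- [::]) f i m *: tau i m) = (fun=> 0).
    by apply: functional_extensionality_dep => x; rewrite big_nil.
  by rewrite big_nil bracket_form0 //; split => //; exact: smooth_ETsM0.
have -> : (fun m => \sum_(j <- i :: s) f j m *: tau j m) =
    (fun m => f i m *: tau i m + \sum_(j <- s) f j m *: tau j m).
  by apply: functional_extensionality_dep => x; rewrite big_cons.
by rewrite big_cons bracket_form_lin // IH; split => //; exact: smooth_ETsM_lin.
Qed.

(** The functional depends on tau at m only through the components of tau at
    m: apply linearity to the expansion of chi^2 tau and divide by
    chi(m)^2. *)
Lemma bracket_form_local nu1 nu2 chi p a tau m :
  smooth_TMEs nu1 -> smooth_TMEs nu2 -> smooth_ETsM tau ->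
  bump_in (dom p `&` tdom E a) chi -> chi m != 0 ->
  bracket_form nu1 nu2 tau m =
  \sum_x frame_coord p a x (tau m) *
     (bracket_form nu1 nu2 (frame_sec E chi p a x) m / chi m).
Proof.
move=> s1 s2 st bchi cm; have [sc _] := bchi.
have H : bracket_form nu1 nu2 (fun x => (chi x * chi x) *: tau x + 0) m =
    (chi m * chi m) * bracket_form nu1 nu2 tau m.
  by rewrite bracket_form_lin ?bracket_form0 ?addr0 //;
     [exact: (smooth_inM openT sc sc)|exact: smooth_ETsM0].
apply: (mulfI (mulf_neq0 cm cm)); rewrite -H.
have -> : (fun x => (chi x * chi x) *: tau x + 0) = fun x =>
   \sum_i (chi x * frame_coord p a i (tau x)) *: frame_sec E chi p a i x.
  apply: functional_extensionality_dep => x; rewrite addr0.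
  exact: frame_expand.
rewrite bracket_form_sum //; first last.
- by move=> i; exact: smooth_frame_sec.
- by move=> i; exact: smooth_frame_coord.
rewrite mulr_sumr; apply: eq_bigr => i _.
have aux (c u v : R) : c != 0 -> c * u * v = c * c * (u * (v / c)).
  by move=> ?; field.
exact: aux.
Qed.

(** The fibres of TM (+) E^* and E (+) T^*M at m are dual, so the values of
    the functional on a frame are the components of a vector. *)
Lemma exists_dual_vector nu1 nu2 m : smooth_TMEs nu1 -> smooth_TMEs nu2 ->
  exists u : (TM m * vdual (E m))%type, forall tau, smooth_ETsM tau ->
    u.2 (tau m).1 + (tau m).2 u.1 = bracket_form nu1 nu2 tau m.
Proof.
move=> s1 s2; have oU : open (dom m `&` tdom E m).
  by apply: openI; [exact: chart_dom_open|exact: tdom_open].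
have Um : (dom m `&` tdom E m) m by split; [exact: mem_chart|exact: mem_tdom].
have [chi bchi cm] := exists_bump oU Um.
pose c x := bracket_form nu1 nu2 (frame_sec E chi m m x) m / chi m.
(* the covector with coordinates c (inl i) in the trivialisation at m *)
pose eps : vdual (E m) :=
  linfun ((coordl 0 : 'rV[R]_1 -> R^o) \o
    (mulmxr (\col_i c (inl i)) : 'rV[R]_k -> 'rV[R]_1) \o (triv E m m)).
exists (\row_j c (inr j), eps) => tau st /=.
rewrite (bracket_form_local s1 s2 st bchi cm) big_sumType /=; congr (_ + _).
  rewrite /eps lfunE /= /coordl mxE.
  by apply: eq_bigr => i _; rewrite !mxE.
rewrite (form_decomp (tau m).2 _ (mem_chart m)).
apply: eq_bigr => j _.
have -> : dvec (map m) (\row_j c (inr j) : TM m) = \row_j c (inr j).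
  exact: diff_transition_id (mem_chart m) _.
by rewrite mxE mulrC.
Qed.

(** The pointwise dual vectors form a smooth section because their components
    in a frame, multiplied by chi, are the values of the functional on the
    cut-off frame. *)
Lemma exists_dual_bracket nu1 nu2 : smooth_TMEs nu1 -> smooth_TMEs nu2 ->
  exists nu, is_dual_bracket D nu1 nu2 nu.
Proof.
move=> s1 s2; pose nu m := sval (cid (exists_dual_vector m s1 s2)).
have nuE tau m : smooth_ETsM tau ->
    pair_sec nu tau m = bracket_form nu1 nu2 tau m.
  by move=> st; rewrite /pair_sec /nu; case: cid => u /= ->.
exists nu; split; last by move=> tau st m; exact: nuE.
split.
  apply/smooth_vfieldP => p j; apply: smooth_in_bump.
    exact: chart_dom_open.
  move=> chi bchi; have sfa := smooth_form_along E j bchi.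
  apply: (smooth_in_eq openT _ (smooth_bracket_form s1 s2 sfa)) => m _.
  rewrite -nuE // /pair_sec /= linear0 add0r scale_lfunE.
  have [->|/(bump_in_neq0 bchi) pm] := eqVneq (chi m) 0.
    by rewrite mul0r scale0r.
  by rewrite dcoordE.
apply/smooth_cosecP => a w; apply: smooth_in_bump; first exact: tdom_open.
move=> chi bchi; have ssa := smooth_sec_along w bchi.
apply: (smooth_in_eq openT _ (smooth_bracket_form s1 s2 ssa)) => m _.
by rewrite -nuE // /pair_sec /= zero_lfunE addr0 linearZ.
Qed.

Lemma dual_bracketE nu1 nu2 tau m : smooth_TMEs nu1 -> smooth_TMEs nu2 ->
  smooth_ETsM tau ->
  pair_sec (dual_bracket D nu1 nu2) tau m = bracket_form nu1 nu2 tau m.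
Proof.
move=> s1 s2 st; rewrite /dual_bracket; case: pselect => [h|].
  by case: (cid h) => /= nu [_ ->].
by move=> H; case: H; exact: exists_dual_bracket.
Qed.

End DualBracket.

(** * Differentials in the fibred charts of E *)

Section TotalSpace.
Context {R : realType} {n : nat} (M : manifold R n) {k : nat} (E : vbundle M k).
Implicit Types (p a m : M).

Local Notation A := (@total_chart_at _ _ _ _ E).
Local Notation AM := (@chart_at _ _ M).

Lemma near_dom_tdom m : \forall x \near map m m, img m (tdom E m) x.
Proof.
apply: near_chart_map; first exact: tdom_open.
  exact: mem_chart.
exact: mem_tdom.
Qed.

Lemma diff_lsubmx (z : 'rV[R]_(n + k)) :
  differentiable (lsubmx : 'rV[R]_(n + k) -> 'rV[R]_n) z /\
  forall w, 'd (lsubmx : 'rV[R]_(n + k) -> 'rV[R]_n) z w = lsubmx w.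
Proof.
split; first exact: differentiable_lsubmx.
move=> w; apply: (congr1 (@^~ w) (@diff_lin _ _ _ lsubmx z _)).
exact: continuous_lsubmx.
Qed.

(** In fibred charts the projection is (x, v) |-> x. *)
Lemma tmap_qE m (v : E m) w :
  tmap A AM (@qE _ _ _ _ E) (tot v) w = lsubmx w.
Proof.
rewrite /tmap; apply: (etrans (lfunE _ _)).
have [dl dlE] := diff_lsubmx (row_mx (map m m) (triv E m m v)).
have mm := mem_chart m.
apply: (etrans (congr1 (@^~ w) (near_eq_diff _ dl))); last exact: dlE.
near=> z; rewrite /=.
have : img m (tdom E m) (lsubmx z).
  near: z; apply: (differentiable_continuous dl).
  rewrite row_mxKl; exact: near_dom_tdom.
by move=> /img_inv[_ _ ->].
Unshelve. all: by end_near. Qed.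

(** In the fibred chart the curve t |-> v + t e is an affine line in the fibre
    direction. *)
Lemma vlift_fst tau m (v : E m) :
  (vlift tau (tot v)).1 = row_mx 0 (triv E m m (tau m).1).
Proof.
rewrite /vlift /velocity /=; set u := row_mx _ _.
have D0 := @is_diff_scalel R _ 0 u.
have DD : is_diff (0 : R) (cst (row_mx (map m m) (triv E m m v)) + ( *:%R ^~ u))
    (0 + ( *:%R ^~ u)) by exact: is_diffD.
have -> : chart_map (A (tot v)) \o (fun t : R => tot (v + t *: (tau m).1)) =
   cst (row_mx (map m m) (triv E m m v)) + ( *:%R ^~ u).
  apply/funext => t; rewrite -[RHS]/(row_mx _ _ + t *: u) /= /u.
  rewrite scale_row_mx scaler0 add_row_mx addr0.
  by rewrite linearD linearZ.
rewrite deriveE; last exact: ex_diff.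
apply: (etrans (congr1 (@^~ 1) diff_val)).
by rewrite -[LHS]/(0 + 1 *: u) add0r scale1r.
Qed.

Lemma vlift_snd tau m (v : E m) (w : TE (tot v)) :
  (vlift tau (tot v)).2 w = (tau m).2 (lsubmx w).
Proof. by rewrite /vlift /= comp_lfunE tmap_qE. Qed.

(** The covector is pulled back from M, and the vector is vertical. *)
Lemma vlift_vlift tau tau' m (v : E m) :
  ((vlift tau (tot v)).2 (vlift tau' (tot v)).1 : R) = 0.
Proof. by rewrite vlift_snd vlift_fst row_mxKl linear0. Qed.

Section Ell.
Context (eps : forall m : M, vdual (E m)) (seps : smooth_cosec eps).

(** In fibred coordinates ell_eps is the sum of the v^i eps_i(x), with eps_i
    smooth. *)
Lemma diff_ell m (v : E m) :
  differentiable (ell eps \o chart_inv (A (tot v)))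
    (chart_map (A (tot v)) (tot v)).
Proof.
set Z := chart_map _ _; have lZ : lsubmx Z = map m m by exact: row_mxKl.
have [dl _] := diff_lsubmx Z.
pose c i x := eps (inv m x) (untriv E m (inv m x) 'e_i) : R.
apply: (@near_eq_differentiable _ _ _
  (fun z : 'rV[R]_(n + k) => \sum_i rsubmx z 0 i * c i (lsubmx z))).
  near=> z.
  have : img m (tdom E m) (lsubmx z).
    near: z; apply: (differentiable_continuous dl).
    rewrite lZ; exact: near_dom_tdom.
  move=> /img_inv[_ mz _]; rewrite /ell /=.
  rewrite [in RHS](untriv_decomp (rsubmx z) mz) linear_sum.
  by apply: eq_bigr => i _; rewrite linearZ.
have -> : (fun z : 'rV[R]_(n + k) => \sum_i rsubmx z 0 i * c i (lsubmx z)) =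
   \sum_i ((fun z : 'rV[R]_(n + k) => rsubmx z 0 i : R) * (c i \o lsubmx)).
  by apply/funext => z; rewrite fct_sumE.
apply: differentiable_sum => i; apply: differentiableM.
  apply: (@differentiable_comp _ _ _ _ rsubmx (fun z => z 0 i : R)).
    exact: differentiable_rsubmx.
  exact: differentiable_coord.
apply: differentiable_comp => //.
rewrite lZ; have [+ _] := seps m m 'e_i 1%N; apply.
by apply: mem_img; [exact: mem_chart|exact: mem_tdom].
Unshelve. all: by end_near. Qed.

(** ell_eps is linear along the fibre, so its difference quotients in a
    vertical direction are constant. *)
Lemma dell_vertical tau m (v : E m) :
  (dfun A (ell eps) (tot v) (vlift tau (tot v)).1 : R) = eps m (tau m).1.
Proof.
apply: (etrans (lfunE _ _)); rewrite vlift_fst.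
have dF := diff_ell v; set Z := chart_map _ _ in dF *.
rewrite -deriveE //; apply: lim_near_cst => //=; near=> h.
have mm := mem_chart m; have tm := mem_tdom E m.
rewrite /ell /= /shift /= -[Z]/(row_mx _ _) /= scale_row_mx add_row_mx.
rewrite !row_mxKl !row_mxKr scaler0 add0r chart_mapK // trivK //.
have -> : untriv E m m (h *: triv E m m (tau m).1 + triv E m m v) =
    h *: (tau m).1 + v.
  by apply: (can_inj (trivK tm)); rewrite untrivK // linearD linearZ.
have -> : eps m (h *: (tau m).1 + v) = h *: eps m (tau m).1 + eps m v.
  by rewrite linearD linearZ.
rewrite addrK scalerA mulVf ?scale1r //.
by near: h; exact: nbhs_dnbhs_neq.
Unshelve. all: by end_near. Qed.

End Ell.

Section Along.
Context (e : forall m : M, E m) (se : smooth_sec e).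

Let tote (m : M) : total_space E := tot (e m).
Let G m := chart_map (A (tote m)) \o tote \o inv m.

(** In coordinates a section is x |-> (x, components of e at x). *)
Lemma diff_G m : differentiable (G m) (map m m).
Proof.
have : C_on 1 (img m (tdom E m)) (G m).
  have ot : open (img m (tdom E m)) by apply: open_img; exact: tdom_open.
  apply: C_on_row => // j; case: (split_ordP j) => i ->.
    apply: (@C_on_eq _ _ _ _ _ (fun x => map m (inv m x) 0 i)) => //.
      by move=> x _; rewrite /G /= row_mxEl.
    apply: C_on_sub (smooth_in_coord m i m 1) => x Ux.
    by apply: img_dom; exact: img_sub Ux.
  apply: (@C_on_eq _ _ _ _ _
    (fun x => triv E m (inv m x) (e (inv m x)) 0 i)) => //.
    by move=> x _; rewrite /G /= row_mxEr.
  apply: (@C_on_coord _ _ _ _ _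
    (fun x => triv E m (inv m x) (e (inv m x)))) => //.
  exact: se.
by move=> [+ _]; apply; apply: mem_img; [exact: mem_chart|exact: mem_tdom].
Qed.

(** The projection after a section is the identity of M. *)
Lemma tmap_qE_along m (X : TM m) : lsubmx (tmap AM A tote m X) = X.
Proof.
have -> : tmap AM A tote m X = 'd (G m) (map m m) X by exact: lfunE.
have dG := diff_G m; have [dl dlE] := diff_lsubmx (G m (map m m)).
apply: (etrans (esym (dlE _))).
apply: (etrans (esym (congr1 (@^~ X) (diff_comp dG dl)))).
apply: (etrans _ (diff_transition_id (mem_chart m) X)).
have H : lsubmx \o G m = map m \o inv m.
  by apply/funext => x; exact: row_mxKl.
exact: (congr1 (fun F : 'rV[R]_n -> 'rV[R]_n => 'd F (map m m) X) H).
Qed.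

(** The chain rule for the identity ell_eps o e = <eps, e>. *)
Lemma dell_along eps m (X : TM m) : smooth_cosec eps ->
  (dfun A (ell eps) (tote m) (tmap AM A tote m X) : R) =
  dfun AM (fun m => eps m (e m) : R) m X.
Proof.
move=> seps.
have -> : tmap AM A tote m X = 'd (G m) (map m m) X by exact: lfunE.
have mm := mem_chart m; have tm := mem_tdom E m.
have GE : G m (map m m) = chart_map (A (tote m)) (tote m).
  by rewrite /G /= chart_mapK.
have dG := diff_G m; have dF := diff_ell seps (e m); rewrite -GE in dF.
apply: (etrans (lfunE _ _)); rewrite -GE.
apply: (etrans (esym (congr1 (@^~ X) (diff_comp dG dF)))).
apply: esym; apply: (etrans (dfunE _ _)).
apply: (congr1 (@^~ X) (near_eq_diff _ (differentiable_comp dG dF))).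
near=> x; have : img m (tdom E m) x by near: x; exact: near_dom_tdom.
move=> /img_inv[px tx _].
by rewrite /ell /G /= row_mxKl row_mxKr chart_mapK // trivK.
Unshelve. all: by end_near. Qed.

End Along.

End TotalSpace.

(** * Pairings of lifts *)

Section Lift.
Context {R : realType} {n : nat} (M : manifold R n) {k : nat} (E : vbundle M k).
Context (D : dorfman E).
Context (e : forall m : M, E m) (se : smooth_sec e).

Lemma smooth_sec_zero : smooth_ETsM (sec_zero e).
Proof. by split => //; exact: smooth_form0. Qed.

Lemma pair_sec_zero (nu : sec_TMEs E) :
  pair_sec nu (sec_zero e) = (fun m => (nu m).2 (e m)).
Proof. by apply/funext => m; rewrite /pair_sec /= zero_lfunE addr0. Qed.

(** The vertical part of the lift is killed by the pulled back covector of the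
    vertical lift, and conversely; what remains is eps(tau_E) + tau_M(X). *)
Lemma hlift_along_vlift nu tau m : smooth_TMEs nu ->
  pair_TT (hlift_along D nu e m) (vlift tau (tot (e m))) = pair_sec nu tau m.
Proof.
move=> [_ snu]; rewrite /pair_TT /hlift_along.
set w := tmap _ _ _ _ _; set V := vlift (D nu _) _; set V' := vlift tau _.
have -> : (((w, dfun (@total_chart_at _ _ _ _ E) (ell (fun m => (nu m).2))
    (tot (e m))) - V).2 V'.1 : R) = (nu m).2 (tau m).1.
  rewrite -[LHS]/((dfun _ _ _ - V.2) _) add_lfunE opp_lfunE.
  rewrite [X in _ - X]vlift_vlift subr0.
  exact: dell_vertical.
congr (_ + _); rewrite vlift_snd; congr ((tau m).2 _).
have V0 : lsubmx V.1 = 0 by rewrite /V vlift_fst; exact: row_mxKl.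
apply: (etrans (linearB lsubmx w V.1)).
rewrite -[LHS]/(lsubmx w - lsubmx V.1) V0 subr0.
exact: tmap_qE_along.
Qed.

(** Each of the two terms of the canonical pairing contributes X2 (eps1(e)) -
    eps1 (pr_E (Delta_nu2 (e, 0))) - pr_M (Delta_nu1 (e, 0)) (X2), or the same
    with 1 and 2 exchanged; regrouping the corrections gives the two
    brackets. *)
Lemma hlift_along_pair nu1 nu2 m : smooth_TMEs nu1 -> smooth_TMEs nu2 ->
  pair_TT (hlift_along D nu1 e m) (hlift_along D nu2 e m) =
  bracket_form D nu1 nu2 (sec_zero e) m + bracket_form D nu2 nu1 (sec_zero e) m.
Proof.
move=> s1 s2.
(* the covector part of the lift of mu on the vector part of the lift of nu *)
have half mu nu : smooth_TMEs mu -> smooth_TMEs nu ->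
    ((hlift_along D mu e m).2 (hlift_along D nu e m).1 : R) =
    anchor nu (pair_sec mu (sec_zero e)) m
    - (mu m).2 (D nu (sec_zero e) m).1 - (D mu (sec_zero e) m).2 (nu m).1.
  move=> [_ smu] _; rewrite pair_sec_zero /hlift_along.
  set w := tmap _ _ _ _ (nu m).1.
  set V := vlift (D nu _) _; set V' := vlift (D mu _) _.
  rewrite -[LHS]/((dfun _ _ _ - V'.2) (w - V.1)) add_lfunE opp_lfunE.
  have V'V : V'.2 V.1 = 0 by exact: vlift_vlift.
  have V'w : V'.2 w = (D mu (sec_zero e) m).2 (nu m).1.
    by rewrite [LHS]vlift_snd tmap_qE_along.
  have fB (f : cotangent (@total_chart_at _ _ _ _ E) (tot (e m))) :
    f (w - V.1) = f w - f V.1 by exact: linearB.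
  rewrite !fB V'V V'w subr0.
  by congr (_ - _ - _); [exact: dell_along|exact: dell_vertical].
rewrite /pair_TT (half nu1 nu2) // (half nu2 nu1) //.
rewrite /bracket_form {4 6}/pair_sec.
have aux (a1 a2 x y z t : R) : a1 - x - y + (a2 - z - t) =
  a2 - (z + y) + (a1 - (x + t)) by ring.
exact: aux.
Qed.

End Lift.

(** The section through x is chosen independently of nu, so all lifts at x may
    be computed with one and the same e. *)
Lemma hliftE (R : realType) (n k : nat) (M : manifold R n) (E : vbundle M k)
   (D : dorfman E) (x : total_space E) :
  exists2 e : forall m : M, E m, smooth_sec e & e (qE x) = projT2 x /\
   forall nu, hlift D nu x = hlift_along D nu e (qE x).
Proof.
have [e0 [se0 e0x]] := exists_smooth_sec_through (projT2 x).
rewrite /hlift; case: pselect => [h|]; last by case; exists e0.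
by case: (cid h) => e [se ex] /=; exists e.
Qed.

Theorem theorem4p5 (R : realType) (n k : nat) (M : manifold R n)
    (E : vbundle M k) (Delta : dorfman E)
    (nu nu1 nu2 : sec_TMEs E) (tau tau1 tau2 : sec_ETsM E)
    (hnu : smooth_TMEs nu) (hnu1 : smooth_TMEs nu1) (hnu2 : smooth_TMEs nu2)
    (htau : smooth_ETsM tau) (htau1 : smooth_ETsM tau1)
    (htau2 : smooth_ETsM tau2) :
  [/\ forall x : total_space E,
        pair_TT (hlift Delta nu1 x) (hlift Delta nu2 x) =
        ell (Skew Delta nu1 nu2) x,
      forall x : total_space E,
        pair_TT (hlift Delta nu x) (vlift tau x) = pair_sec nu tau (qE x)
    & forall x : total_space E,
        pair_TT (vlift tau1 x) (vlift tau2 x) = 0].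
Proof.
split=> x.
- have [e se [ex hE]] := hliftE Delta x; rewrite !hE.
  apply: (etrans (hlift_along_pair Delta se (qE x) hnu1 hnu2)).
  have sz := smooth_sec_zero se.
  rewrite -!dual_bracketE // /pair_sec /= !zero_lfunE !addr0.
  rewrite /ell /Skew /= add_lfunE.
  by rewrite ex.
- have [e se [ex hE]] := hliftE Delta x; rewrite hE.
  have -> : vlift tau x = vlift tau (tot (e (qE x))).
    by move: ex; case: x {hE} => m v /= <-.
  exact: (hlift_along_vlift Delta se tau (qE x) hnu).
- case: x => m v; rewrite /pair_TT.
  by rewrite !vlift_vlift addr0.
Qed.
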